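(* Let $K$ be an algebraically closed field (of possibly positive characteristic) that is complete with respect to a non-trivial, possibly non-archimedean, absolute value $|\cdot|$. Let $g$ be a normalized weight on the Berkovich projective line $\mathsf{P}^1=\mathsf{P}^1(K)$, and suppose that the restriction $g|\mathbb{P}^1$ is $1/\kappa$-Hölder continuous on $(\mathbb{P}^1,[z,w])$ for some $\kappa\ge 1$, i.e. $C:=\sup_{z,w\in\mathbb{P}^1,\ z\neq w}|g(z)-g(w)|/[z,w]^{1/\kappa}$ is a finite non-negative real number. Set $C':=C\cdot 2^{1/\kappa}$ if $K$ is non-archimedean and $C':=C$ otherwise, and set $\epsilon_K:=1$ if $K$ is archimedean and $\epsilon_K:=0$ otherwise. Then for every non-empty finite subset $F\subset\mathbb{P}^1$, \[ \sum_{z\in F}\sum_{w\in F\setminus\{z\}}\Phi_g(z,w)\le \kappa\cdot(\#F)\log(\#F)+2(\#F)\Bigl(C'+\epsilon_K\cdot(\#F)^{1-\kappa}+\sup_{\mathsf{P}^1}|g|\Bigr). \] In particular, \[ \limsup_{N\to\infty}\Biggl(\sup_{F\subset\mathbb{P}^1:\,0<\#F\le N}\frac{\sum_{z\in F}\sum_{w\in F\setminus\{z\}}\Phi_g(z,w)}{(\#F)\log(\#F)}\Biggr)\le\kappa. \]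
   Context: $\mathbb{P}^1=\mathbb{P}^1(K)$ is the classical projective line and $\mathsf{P}^1=\mathsf{P}^1(K)$ the Berkovich projective line over $K$ (a compact space containing $\mathbb{P}^1$ as a dense subset; $\mathsf{P}^1=\mathbb{P}^1$ when $K$ is archimedean, i.e. $K\cong\mathbb{C}$). On $K^2$ let $\|(p_0,p_1)\|=\max\{|p_0|,|p_1|\}$ if $K$ is non-archimedean and $\sqrt{|p_0|^2+|p_1|^2}$ if archimedean; the normalized chordal metric on $\mathbb{P}^1$ is $[z,w]=|p_0q_1-p_1q_0|/(\|p\|\|q\|)$ for lifts $p=(p_0,p_1)$ of $z$ and $q=(q_0,q_1)$ of $w$ (where $(p_0,p_1)$ lifts $p_1/p_0$). The kernel $[\mathcal{S},\mathcal{S}']_{\mathrm{can}}$ on $\mathsf{P}^1\times\mathsf{P}^1$ is: for non-archimedean $K$, the generalized Hsia kernel with respect to the Gauss point, i.e. the unique jointly upper semicontinuous and separately continuous extension of $[z,w]$ to $\mathsf{P}^1\times\mathsf{P}^1$; for archimedean $K$, $[z,w]$ itself. Let $\Omega_{\mathrm{can}}$ be the Dirac measure at the Gauss (canonical) point $\mathcal{S}_{\mathrm{can}}$ (the point corresponding to the closed unit disk $\{|z|\le1\}$) if $K$ is non-archimedean, and the Fubini–Study area measure on $\mathbb{P}^1$ normalized to total mass $1$ if $K$ is archimedean. The Laplacian $\Delta$ on $\mathsf{P}^1$ is normalized so that $\Delta\log[\cdot,\mathcal{S}']_{\mathrm{can}}=\delta_{\mathcal{S}'}-\Omega_{\mathrm{can}}$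 for every $\mathcal{S}'\in\mathsf{P}^1$. A continuous weight is a continuous function $g$ on $\mathsf{P}^1$ such that $\mu^g:=\Delta g+\Omega_{\mathrm{can}}$ is a probability Radon measure. For such $g$, $\Phi_g(\mathcal{S},\mathcal{S}'):=\log[\mathcal{S},\mathcal{S}']_{\mathrm{can}}-g(\mathcal{S})-g(\mathcal{S}')$, and $V_g:=\sup_\nu\int_{\mathsf{P}^1\times\mathsf{P}^1}\Phi_g\,d(\nu\times\nu)$ over all probability Radon measures $\nu$ on $\mathsf{P}^1$ (this is a real number). A normalized weight is a continuous weight $g$ with $V_g=0$.
   Formalization: In the final limsup the supremum is taken over finite F with #F ≥ N (N > 0) instead of 0 < #F ≤ N; as printed the claim is undefined at #F = 1 and false, e.g. for a two-point F = {0,1} with a suitable Lipschitz normalized weight over non-archimedean K. *)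

(* Defs.v *)
From HB Require Import structures.
From mathcomp Require Import all_boot all_order all_algebra finmap.
From mathcomp Require Import all_classical all_reals all_analysis.
From mathcomp Require Import complex.

Set Implicit Arguments.
Unset Strict Implicit.
Unset Printing Implicit Defensive.

Import Order.TTheory GRing.Theory Num.Theory.
Import numFieldNormedType.Exports.

Local Open Scope classical_set_scope.
Local Open Scope ring_scope.

Record absvalue (R : realType) (K : fieldType) := AbsValue {
  absv :> K -> R;
  absv_ge0 : forall x, 0 <= absv x;
  absv_eq0 : forall x, (absv x == 0) = (x == 0);
  absvM : forall x y, absv (x * y) = absv x * absv y;
  absvD : forall x y, absv (x + y) <= absv x + absv y }.

Section absolute_values.
Context {R : realType} {K : fieldType}.
Implicit Type v : absvalue R K.

Definition nontrivial_abs v := exists x, x != 0 /\ v x != 1.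

Definition complete_abs v := forall u : nat -> K,
  (forall e : R, 0 < e -> exists N, forall m n,
     (N <= m)%N -> (N <= n)%N -> v (u m - u n) < e) ->
  exists l, forall e : R, 0 < e -> exists N, forall n,
     (N <= n)%N -> v (u n - l) < e.

Definition nonarchimedean v :=
  forall x y, v (x + y) <= Num.max (v x) (v y).

(* [sigma] identifies the complex numbers, with their usual absolute value,
   with [K]. *)
Definition complex_iso v (sigma : {rmorphism R[i] -> K}) :=
  bijective sigma /\
  forall x y : R, v (sigma (x +i* y)%C) = Num.sqrt (x ^+ 2 + y ^+ 2).

End absolute_values.

(* The classical projective line; [None] is the point at infinity. *)
Definition P1 (K : Type) : Type := option K.
HB.instance Definition _ (K : choiceType) := Choice.on (P1 K).

Section chordal_metric.
Context {R : realType} {K : fieldType} (v : absvalue R K).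

(* [(p0, p1)] is a lift of [p1 / p0]. *)
Definition lift (z : P1 K) : K * K :=
  if z is Some x then (1, x) else (0, 1).

Definition norm2 (p : K * K) : R :=
  if `[< nonarchimedean v >] then Num.max (v p.1) (v p.2)
  else Num.sqrt (v p.1 ^+ 2 + v p.2 ^+ 2).

Definition chordal (z w : P1 K) : R :=
  let p := lift z in let q := lift w in
  v (p.1 * q.2 - p.2 * q.1) / (norm2 p * norm2 q).

End chordal_metric.

Record mult_seminorm (R : realType) (K : fieldType) (v : absvalue R K)
    (s : {poly K} -> R) : Prop := MultSeminorm {
  mult_seminorm_ge0 : forall f, 0 <= s f;
  mult_seminormC : forall c, s c%:P = v c;
  mult_seminormM : forall f h, s (f * h) = s f * s h;
  mult_seminormD : forall f h, s (f + h) <= s f + s h }.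

(* The Berkovich affine line: multiplicative seminorms on K[T] extending v,
   with the topology of pointwise convergence. *)
Record A1berk (R : realType) (K : fieldType) (v : absvalue R K) := A1Berk {
  seminorm :> {poly K} -> R;
  seminormP : mult_seminorm v seminorm }.

HB.instance Definition _ R K v := gen_eqMixin (@A1berk R K v).
HB.instance Definition _ R K v := gen_choiceMixin (@A1berk R K v).
HB.instance Definition _ (R : realType) (K : fieldType) (v : absvalue R K) :=
  Topological.copy (A1berk v)
    (initial_topology
       (@seminorm R K v : A1berk v -> prod_topology (fun _ : {poly K} => R))).

(* The Berkovich projective line.  When K is the field of complex numbers the
   only multiplicative seminorms on K[T] extending v are the evaluations
   (Gelfand-Mazur), so that this is the classical projective line. *)
Notation P1berk v := (one_point_compactification (A1berk v)).
Notation P1borel v := (g_sigma_algebraType (@open (P1berk v))).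

Section berkovich_line.
Context {R : realType} {K : fieldType} (v : absvalue R K).

Lemma eval_mult_seminorm (z : K) : mult_seminorm v (fun f => v f.[z]).
Proof.
split=> [f|c|f h|f h]; rewrite ?hornerE; [|by []|exact: absvM|exact: absvD].
exact: absv_ge0.
Qed.

Definition typeI (z : P1 K) : P1berk v :=
  if z is Some x then Some (A1Berk (eval_mult_seminorm x)) else None.

Definition hyperbolic : set (P1berk v) := ~` range typeI.

(* The seminorm attached to a closed disk is the supremum over that disk. *)
Definition is_gauss_point (S : P1berk v) :=
  exists x : A1berk v, S = Some x /\
    forall f, x f = sup [set v f.[z] | z in [set z | v z <= 1]].

(* On a compact Hausdorff space. *)
Definition radon (mu : probability (P1borel v) R) :=
  forall A : set (P1borel v), measurable A ->
    mu A = ereal_sup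
      [set mu C | C in [set C : set (P1berk v) |
                         compact C /\ closed C /\ C `<=` A]].

(* The canonical kernel: the extension of the chordal metric that is jointly
   upper semicontinuous and separately continuous. *)
Definition is_can_kernel (H : P1berk v -> P1berk v -> R) :=
  [/\ forall z w, H (typeI z) (typeI w) = chordal v z w,
      forall r, open [set p : P1berk v * P1berk v | H p.1 p.2 < r],
      forall S, continuous (H S)
    & forall S', continuous (fun S => H S S')].

End berkovich_line.

(* Smooth functions on the real plane, [D_x] and [D_y] being the partial
   derivatives. *)
Section plane.
Context {R : realType}.

Definition D_x (f : R * R -> R) : R * R -> R := 'D_((1, 0) : R * R) f.
Definition D_y (f : R * R -> R) : R * R -> R := 'D_((0, 1) : R * R) f.

Fixpoint Cn (n : nat) (f : R * R -> R) : Prop :=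
  continuous f /\
  if n is m.+1 then
    (forall p, derivable f p (1, 0) /\ derivable f p (0, 1)) /\
    Cn m (D_x f) /\ Cn m (D_y f)
  else True.

Definition smooth (f : R * R -> R) := forall n, Cn n f.

Definition leb2 : set (R * R) -> \bar R :=
  (@lebesgue_measure R \x @lebesgue_measure R)%E.

End plane.

Section archimedean_laplacian.
Context {R : realType} {K : fieldType} (v : absvalue R K).
Variable sigma : {rmorphism R[i] -> K}.

Definition chart0 (p : R * R) : P1berk v :=
  typeI v (Some (sigma (p.1 +i* p.2)%C)).

Definition chartoo (p : R * R) : P1berk v :=
  typeI v (if p == 0 then None else Some (sigma (p.1 +i* p.2)%C)^-1).

(* Normalized Fubini-Study area; the point at infinity has mass 0. *)
Definition fubini_study (A : set (P1berk v)) : \bar R :=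
  (\int[leb2]_(p in chart0 @^-1` A)
     ((pi * (1 + p.1 ^+ 2 + p.2 ^+ 2) ^+ 2)^-1)%:E)%E.

Definition test_function (phi : P1berk v -> R) :=
  smooth (phi \o chart0) /\ smooth (phi \o chartoo).

(* [Delta g = mu - nu] in the sense of distributions, where Delta is 1 / (2 pi)
   times the usual Laplacian in the coordinate z = x + iy.  For a smooth
   function phi on the sphere, Delta phi is a smooth 2-form, so that the
   integral over the plane is the integral over the sphere. *)
Definition laplacian_arch (g : P1berk v -> R)
    (mu nu : probability (P1borel v) R) :=
  forall phi, test_function phi ->
    \int[mu]_S phi S - \int[nu]_S phi S =
    \int[leb2]_p
      (g (chart0 p) * ((2 * pi)^-1 *
        (D_x (D_x (phi \o chart0)) p + D_y (D_y (phi \o chart0)) p))).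

End archimedean_laplacian.

Section nonarchimedean_laplacian.
Context {R : realType} {K : fieldType} (v : absvalue R K).
Variable H : P1berk v -> P1berk v -> R.

(* The path metric on hyperbolic space: [- ln (H S S')] is the Gromov product
   of S and S' based at the Gauss point. *)
Definition hyp_dist (S S' : P1berk v) : R :=
  2 * ln (H S S') - ln (H S S) - ln (H S' S').

(* The points of the segment [S, S0], for S and S0 hyperbolic. *)
Definition segment (S S0 : P1berk v) : set (P1berk v) :=
  [set S' | hyperbolic S' /\
            hyp_dist S S' + hyp_dist S' S0 = hyp_dist S S0].

(* The one-sided derivative of g at S in the tangent direction of S0, with
   respect to the path metric, exists and is equal to d. *)
Definition slope (g : P1berk v -> R) (S S0 : P1berk v) (d : R) :=
  forall e : R, 0 < e -> exists delta : R, 0 < delta /\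
    forall S', segment S S0 S' -> S' != S -> hyp_dist S S' < delta ->
      `|(g S' - g S) / hyp_dist S S' - d| < e.

(* [Delta g = mu - nu]: the connected component U of the complement of S in a
   tangent direction has mass - (slope of g at S in that direction).  For
   continuous g these masses determine mu - nu, and mu - nu determines g up to
   an additive constant. *)
Definition laplacian_nonarch (g : P1berk v -> R)
    (mu nu : probability (P1borel v) R) :=
  forall S S0, hyperbolic S -> hyperbolic S0 -> S0 != S ->
    let U := connected_component (~` [set S]) S0 in
    slope g S S0 (- (fine (mu U) - fine (nu U))).

End nonarchimedean_laplacian.

Section weights.
Context {R : realType} {K : fieldType} (v : absvalue R K).
Variable H : P1berk v -> P1berk v -> R.

(* The choice of [sigma] is irrelevant here and in [laplacian]: two
   identifications of K with the complex numbers differ at most by complex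
   conjugation. *)
Definition is_Omega_can (omega : probability (P1borel v) R) :=
  if `[< nonarchimedean v >] then
    exists S : P1borel v, @is_gauss_point R K v S /\
      forall A : set (P1borel v), measurable A -> omega A = \d_S A
  else
    exists sigma : {rmorphism R[i] -> K}, complex_iso v sigma /\
      forall A : set (P1borel v), measurable A ->
        omega A = fubini_study sigma A.

Definition laplacian (g : P1berk v -> R) (mu nu : probability (P1borel v) R) :=
  if `[< nonarchimedean v >] then laplacian_nonarch H g mu nu
  else exists sigma : {rmorphism R[i] -> K}, complex_iso v sigma /\
         laplacian_arch sigma g mu nu.

(* [mu] is the measure Delta g + Omega_can. *)
Definition continuous_weight (g : P1berk v -> R) :=
  continuous g /\
  exists mu omega : probability (P1borel v) R,
    [/\ radon mu, is_Omega_can omega & laplacian g mu omega].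

Definition Phi (g : P1berk v -> R) (S S' : P1berk v) : \bar R :=
  (lne (H S S')%:E - (g S)%:E - (g S')%:E)%E.

(* The integral against the Radon product nu x nu, written as an iterated
   integral: the kernel is Borel for the product topology, but in general not
   measurable for the product of the Borel sigma-algebras, since the Berkovich
   line need not be second countable. *)
Definition energy (g : P1berk v -> R) (nu : probability (P1borel v) R) :
    \bar R :=
  (\int[nu]_S \int[nu]_S' Phi g S S')%E.

Definition equilibrium_energy (g : P1berk v -> R) : \bar R :=
  ereal_sup [set energy g nu | nu in [set nu | radon nu]].

Definition normalized_weight (g : P1berk v -> R) :=
  continuous_weight g /\ equilibrium_energy g = 0%E.

Definition holder_quotients (g : P1berk v -> R) (kappa : R) : set R :=
  [set r | exists z w : P1 K, z != w /\
     r = `|g (typeI v z) - g (typeI v w)| / chordal v z w `^ kappa^-1].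

Definition fekete_sum (g : P1berk v -> R) (F : {fset P1 K}) : \bar R :=
  (\sum_(z <- F) \sum_(w <- F | w != z) Phi g (typeI v z) (typeI v w))%E.

End weights.

(* Main.v *)
Require Import Defs.
From HB Require Import structures.
From mathcomp Require Import all_boot all_order all_algebra finmap.
From mathcomp Require Import all_classical all_reals all_analysis.
From mathcomp Require Import complex measurable_realfun ring lra.

Set Implicit Arguments.
Unset Strict Implicit.
Unset Printing Implicit Defensive.

Import Order.TTheory GRing.Theory Num.Theory.
Import numFieldNormedType.Exports.

Local Open Scope classical_set_scope.
Local Open Scope ring_scope.

(* For a probability measure nu the energy of Phi_g is at most V_g = 0.  Given
   n points z_i, spread the unit mass of each of them over a small chordal
   circle of radius s: replace z_i by a measure m_i, and take nu to be the mean
   of the m_i.  The regularized potentials dominate log [z_i, z_j] up to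
   log (1 - s^2), the self-energy of m_i is about log s, and Hoelder continuity
   bounds the variation of g by C s^(1/kappa); the choice s = n^(-kappa) then
   gives the estimate.

   If K is non-archimedean, m_i is a Dirac mass at a cluster point of a sequence
   w_k with [w_k, z_i] = [w_k, w_l] = s.  Such sequences exist because the
   residue field is infinite, and for every y the distance [w_k, y] is
   eventually max(s, [z_i, y]), which determines the kernel at the cluster point
   by separate continuity.  The radius s has to lie in the value group, which is
   dense.

   If K is the field of complex numbers, m_i is the uniform measure on the
   circle.  In terms of a unitary frame (p, q) adapted to z_i the points of the
   circle have lifts c p + s e^(it) q with c^2 + s^2 = 1, so that the potential
   is the mean of log |A + B e^(it)|, which is log max(|A|, |B|) by Jensen's
   formula.

   To treat both cases at once, m_i is always the image of the Lebesgue measure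
   of [0, 1] by a curve in the Berkovich affine line. *)

(** * Means of image measures *)

Section extended_integral.
Local Open Scope ereal_scope.
Context d (T : measurableType d) (R : realType).
Implicit Types f g : T -> \bar R.

(** Positive and negative parts are compared separately, which covers integrals equal to -oo, as
    they occur for logarithmic kernels. *)
Lemma le_integral_measurable (mu : {measure set T -> \bar R}) f g :
  measurable_fun setT f -> measurable_fun setT g ->
  (forall x, f x <= g x) -> \int[mu]_x f x <= \int[mu]_x g x.
Proof.
move=> mf mg fg; rewrite (integralE _ _ f) (integralE _ _ g).
apply: leeB; apply: ge0_le_integral => //=.
- exact: measurable_funepos.
- exact: measurable_funepos.
- by move=> x _; apply: (@funepos_le _ _ setT) => //; rewrite ?inE.
- exact: measurable_funeneg.
- exact: measurable_funeneg.
- by move=> x _; apply: (@funeneg_le _ _ setT) => //; rewrite ?inE.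
Qed.

Variable P : probability T R.

Lemma integral_funepos_fin_num (M : R) f :
  measurable_fun setT f -> (forall x, f x <= M%:E) ->
  \int[P]_x f^\+ x \is a fin_num.
Proof.
move=> mf fM; rewrite ge0_fin_numE; last exact: integral_ge0.
apply: (@le_lt_trans _ _ (\int[P]_x (Num.max M 0)%:E)).
  apply: ge0_le_integral => //=; first exact: measurable_funepos.
  by move=> x _; rewrite funeposE EFin_max ge_max !le_max fM lexx orbT.
by rewrite integral_cst//= probability_setT mule1 ltry.
Qed.

Lemma integral_ub (M : R) f : measurable_fun setT f ->
  (forall x, f x <= M%:E) -> \int[P]_x f x <= M%:E.
Proof.
move=> mf fM; rewrite -[leRHS]mule1 -(@probability_setT _ _ _ P).
by rewrite -integral_cst//; apply: le_integral_measurable.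
Qed.

(** The upper bound makes the positive part integrable; a negative part with infinite integral would
    make the integral -oo, against the lower bound [r]. *)
Lemma integrable_bounded_above (M r : R) f :
  measurable_fun setT f -> (forall x, f x <= M%:E) ->
  r%:E <= \int[P]_x f x -> P.-integrable setT f.
Proof.
move=> mf fM rf; apply/integrableP; split => //.
have p := integral_funepos_fin_num mf fM.
rewrite [ltLHS](_ : _ = \int[P]_x (f^\+ x + f^\- x)); last first.
  by apply: eq_integral => x _; rewrite -[RHS]/((f^\+ \+ f^\-) x) -fune_abse.
rewrite ge0_integralD//; last 2 first.
  exact: measurable_funepos.
  exact: measurable_funeneg.
rewrite integralE in rf.
rewrite lte_add_pinfty//; first by rewrite ltey_eq p.
rewrite ltNge; apply/negP; rewrite leye_eq => /eqP n.
by move: rf; rewrite n -(fineK p).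
Qed.

(** A finite integral is additive, an integral equal to -oo makes the left side -oo, and the upper
    bound excludes +oo. *)
Lemma le_integral_shift (M k : R) f :
  measurable_fun setT f -> (forall x, f x <= M%:E) ->
  \int[P]_x f x + k%:E <= \int[P]_x (f x + k%:E).
Proof.
move=> mf fM.
have := integral_ub mf fM.
case fE : (\int[P]_x f x) => [r| |]//= _.
  rewrite integralD//=.
  - by rewrite fE integral_cst//= probability_setT mule1.
  - by apply: (@integrable_bounded_above M r) => //; rewrite fE.
  - exact: finite_measure_integrable_cst.
by rewrite leNye.
Qed.

End extended_integral.

Section average_of_pushforwards.
Local Open Scope ereal_scope.
Context d d' (T : measurableType d) (X : measurableType d') (R : realType).
Variables (P : probability T R) (n : nat) (gamma : nat -> {mfun T >-> X}).

(** The mean [nu] of the overview, for a general source law [P]. Counting the curves by [n.+1] keeps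
    the normalizing factor invertible. *)
Definition pushforward_average : set X -> \bar R :=
  mscale ((n.+1%:R^-1 : R)%:nng)%R
    (msum (fun i => distribution P (gamma i)) n.+1).

HB.instance Definition _ := Measure.on pushforward_average.

Lemma pushforward_average_setT : pushforward_average setT = 1.
Proof.
rewrite /pushforward_average /mscale/= /msum.
rewrite (eq_bigr (fun=> 1)); last by move=> i _; exact: probability_setT.
by rewrite sumEFin sumr_const card_ord -EFinM mulVf.
Qed.

HB.instance Definition _ := Measure_isProbability.Build _ _ _
  pushforward_average pushforward_average_setT.

Lemma ge0_integral_pushforward_average (f : X -> \bar R) :
  measurable_fun setT f -> (forall x, 0 <= f x) ->
  \int[pushforward_average]_x f x =
  (n.+1%:R^-1)%R%:E * \sum_(i < n.+1) \int[P]_t f (gamma i t).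
Proof.
move=> mf f0; rewrite /pushforward_average ge0_integral_mscale//=.
rewrite ge0_integral_measure_sum//; congr (_ * _).
by apply: eq_bigr => i _; rewrite ge0_integral_distribution.
Qed.

(** Along each curve the positive part of [f] has finite integral, so the difference of the formulas
    for [f^\+] and [f^\-] can be regrouped term by term. *)
Lemma integral_pushforward_average (M : R) (f : X -> \bar R) :
  measurable_fun setT f -> (forall i t, (i <= n)%N -> f (gamma i t) <= M%:E) ->
  \int[pushforward_average]_x f x =
  (n.+1%:R^-1)%R%:E * \sum_(i < n.+1) \int[P]_t f (gamma i t).
Proof.
move=> mf fM; rewrite integralE !ge0_integral_pushforward_average//; last 2 first.
  exact: measurable_funeneg.
  exact: measurable_funepos.
have p (i : 'I_n.+1) : \int[P]_t f^\+ (gamma i t) \is a fin_num.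
  have := @integral_funepos_fin_num _ _ _ P M (f \o gamma i).
  rewrite funepos_comp; apply; first exact: measurableT_comp.
  by move=> t; exact: fM (ltn_ord i).
rewrite -muleBr//; last first.
  by apply: fin_num_adde_defr; apply/sum_fin_numP => i _ _; exact: p.
congr (_ * _); rewrite -sumeN; last first.
  move=> i j _ _; apply: ge0_adde_def; rewrite inE;
  by apply: integral_ge0.
rewrite -big_split/=; apply: eq_bigr => i _.
rewrite [RHS](integralE P setT (f \o gamma i)).
by rewrite (funepos_comp f (gamma i)) (funeneg_comp f (gamma i)).
Qed.


Let nu : probability X R := pushforward_average.

(** Joint measurability of [k] on [X * X] is not assumed. Expanding the mean leaves integrals over
    [T], and Fubini-Tonelli applies on [X * T] to the positive and the negative part of [k]. *)
Lemma measurable_integral_pushforward_average (k : X -> X -> \bar R) :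
  (forall x, measurable_fun setT (k x)) ->
  (forall i, measurable_fun setT (fun z : X * T => k z.1 (gamma i z.2))) ->
  measurable_fun setT (fun x => \int[nu]_y k x y).
Proof.
move=> mk mkg; rewrite (_ : (fun _ => _) = (fun x =>
    (n.+1%:R^-1)%R%:E * \sum_(i < n.+1) \int[P]_t (k x)^\+ (gamma i t) -
    (n.+1%:R^-1)%R%:E * \sum_(i < n.+1) \int[P]_t (k x)^\- (gamma i t))); last first.
  apply/funext => x; rewrite integralE !ge0_integral_pushforward_average//.
    exact: measurable_funeneg.
  exact: measurable_funepos.
have pm (h : \bar R -> \bar R) (i : nat) : measurable_fun setT h ->
    (forall y, 0 <= h y) ->
    measurable_fun setT (fun x => \int[P]_t h (k x (gamma i t))).
  move=> mh h0.
  apply: (@measurable_fun_fubini_tonelli_F _ _ _ _ _ P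
    (fun z : X * T => h (k z.1 (gamma i z.2)))) => //.
  exact: measurableT_comp.
apply: emeasurable_funB; apply: measurable_funeM; apply: emeasurable_sum => i.
- under eq_fun do under eq_integral do rewrite funeposE.
  apply: (pm (fun y => maxe y 0)) => [|y]; last by rewrite le_max lexx orbT.
  by apply: measurable_maxe.
- under eq_fun do under eq_integral do rewrite funenegE.
  apply: (pm (fun y => maxe (- y) 0)) => [|y]; last by rewrite le_max lexx orbT.
  by apply: measurable_maxe.
Qed.

(** The estimate has two stages: [b i j] bounds from below the mean over the second curve at a fixed
    parameter of the first, and [D i j] bounds the mean of [b i j]. The common upper bound [M]
    excludes the value +oo throughout. *)
Lemma le_double_integral_pushforward_average (M : R) (k : X -> X -> \bar R)
    (b : nat -> nat -> T -> \bar R) (D : nat -> nat -> R) :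
  (forall x, measurable_fun setT (k x)) ->
  (forall i, measurable_fun setT (fun z : X * T => k z.1 (gamma i z.2))) ->
  (forall i j s t, (i <= n)%N -> (j <= n)%N ->
     k (gamma i s) (gamma j t) <= M%:E) ->
  (forall i j, measurable_fun setT (b i j)) ->
  (forall i j t, (i <= n)%N -> (j <= n)%N -> b i j t <= M%:E) ->
  (forall i j s, (i <= n)%N -> (j <= n)%N ->
     b i j s <= \int[P]_t k (gamma i s) (gamma j t)) ->
  (forall i j, (i <= n)%N -> (j <= n)%N -> (D i j)%:E <= \int[P]_s b i j s) ->
  ((n.+1%:R^-1) ^+ 2 * \sum_(i < n.+1) \sum_(j < n.+1) D i j)%R%:E <=
  \int[nu]_x \int[nu]_y k x y.
Proof.
move=> mk mkg kM mb bM bk Db.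
have n0 : 0 <= (n.+1%:R^-1 : R)%R%:E by rewrite lee_fin.
pose F x := \int[nu]_y k x y.
have mF : measurable_fun setT F by exact: measurable_integral_pushforward_average.
have FE i s : (i <= n)%N -> F (gamma i s) =
    (n.+1%:R^-1)%R%:E * \sum_(j < n.+1) \int[P]_t k (gamma i s) (gamma j t).
  by move=> ni; rewrite /F (@integral_pushforward_average M)// => j t nj; exact: kM.
have kP i s (j : 'I_n.+1) : (i <= n)%N ->
    \int[P]_t k (gamma i s) (gamma j t) <= M%:E.
  move=> ni; apply: integral_ub; first exact: measurableT_comp.
  by move=> t; apply: kM => //; rewrite -ltnS.
have FM i s : (i <= n)%N -> F (gamma i s) <= M%:E.
  move=> ni; rewrite FE//.
  apply: (@le_trans _ _ ((n.+1%:R^-1)%R%:E * \sum_(j < n.+1) M%:E)).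
    by apply: lee_wpmul2l => //; apply: lee_sum => j _; exact: kP.
  by rewrite sumEFin sumr_const card_ord -(mulr_natl M) -EFinM mulKf.
rewrite (@integral_pushforward_average M F mF FM).
rewrite expr2 -mulrA EFinM; apply: lee_wpmul2l; first exact: n0.
rewrite mulr_sumr -sumEFin; apply: lee_sum => i _.
have ni : (i <= n)%N by rewrite -ltnS.
apply: (@le_trans _ _ (\int[P]_s ((n.+1%:R^-1)%R%:E * \sum_(j < n.+1) b i j s))).
  have ib (j : 'I_n.+1) : P.-integrable setT (b i j).
    apply: (@integrable_bounded_above _ _ _ _ M (D i j)) => //.
      by move=> s; apply: bM => //; rewrite -ltnS.
    by apply: Db => //; rewrite -ltnS.
  rewrite integralZl//; last by apply: integrable_sum.
  rewrite EFinM; apply: lee_wpmul2l => //.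
  rewrite integral_sum// -sumEFin; apply: lee_sum => j _.
  by apply: Db => //; rewrite -ltnS.
apply: le_integral_measurable.
- by apply: measurable_funeM; exact: emeasurable_sum.
- exact: (measurableT_comp mF).
- move=> s; rewrite FE//; apply: lee_wpmul2l => //; apply: lee_sum => j _.
  by apply: bk => //; rewrite -ltnS.
Qed.

End average_of_pushforwards.

(** * Measurability of the kernel along curves *)

Section measurability.
Context {R : realType}.

(** Rounding [t] down to a multiple of [1 / N.+1] gives functions that converge pointwise, by
    continuity in [t]. *)
Lemma measurable_caratheodory d (X : measurableType d) (h : X -> R -> R) :
  (forall t, measurable_fun setT (h^~ t)) -> (forall x, continuous (h x)) ->
  measurable_fun setT (fun z : X * R => h z.1 z.2).
Proof.
move=> mh ch; apply/measurable_EFinP.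
pose fl (N : nat) (t : R) : R := (Num.floor (N.+1%:R * t))%:~R / N.+1%:R.
apply: (emeasurable_fun_cvg (fun N (z : X * R) => (h z.1 (fl N z.2))%:E)).
  (* The rounded function depends on [x] alone on each of countably many strips, so that a preimage
     is a countable union of rectangles. *)
  move=> N; apply/measurable_EFinP => _ Y mY; rewrite setTI.
  rewrite (_ : _ @^-1` _ = \bigcup_(k : int)
      (((h^~ (k%:~R / N.+1%:R)) @^-1` Y) `*`
       [set t : R | Num.floor (N.+1%:R * t) = k])); last first.
    apply/seteqP; split=> [[x t] /= Yx|[x t] [k _ /= [Yx kt]]].
      by exists (Num.floor (N.+1%:R * t)).
    by rewrite /fl kt.
  apply: countable_bigcupT_measurable => // k.
  apply: measurableX; first by rewrite -[X in measurable X]setTI; exact: mh.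
  rewrite (_ : [set _ | _] = `[k%:~R / N.+1%:R, (k + 1)%:~R / N.+1%:R[%classic).
    exact: measurable_itv.
  apply/seteqP; split=> t /=; rewrite in_itv/= ler_pdivrMr// ltr_pdivlMr//.
    by move=> <-; rewrite mulrC floor_le floorD1_gt.
  by rewrite mulrC => tk; exact: floor_def.
move=> [x t] _ /=; apply: (@cvg_comp _ _ _ (fun N => h x (fl N t)) EFin _ (nbhs (h x t))) => //.
apply: continuous_cvg; first exact: ch.
apply/cvgrPdist_le => e e0; near=> N.
rewrite ler_norml; apply/andP.
have N0 : 0 < N.+1%:R :> R by [].
have := floor_le (N.+1%:R * t); have := floorD1_gt (N.+1%:R * t).
rewrite intrD /fl; set k := (Num.floor _)%:~R : R => k1 k2.
have Ne : 1 <= N.+1%:R * e.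
  rewrite -[leLHS](mulfV (lt0r_neq0 N0)) ler_pM2l//; apply/ltW; near: N.
  exact: (@near_infty_natSinv_lt R (PosNum e0)).
have -> : t - k / N.+1%:R = (N.+1%:R * t - k) / N.+1%:R.
  by rewrite mulrBl (mulrC _ t) mulfK.
rewrite ler_pdivlMr// ler_pdivrMr//; split; first by rewrite (@le_trans _ _ 0)//; nra.
lra.
Unshelve. all: by end_near. Qed.

Lemma measurable_lne_EFin : measurable_fun setT (fun r : R => lne r%:E).
Proof.
rewrite (_ : (fun _ => _) =
    (fun r : R => if 0 < r then (ln r)%:E else -oo%E)); last first.
  apply/funext => r; case: ltP => r0; first by rewrite lne_EFin.
  by rewrite le0_lneNy.
apply: measurable_fun_ifT => //; first exact: measurable_fun_ltr.
by apply/measurable_EFinP; exact: measurable_ln.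
Qed.

Lemma continuous_measurable_borel (X : ptopologicalType) (f : X -> R) :
  continuous f ->
  measurable_fun setT (f : g_sigma_algebraType (@open X) -> R).
Proof.
move=> cf; apply: (measurability _ (RGenOInfty.measurableE R)).
move=> _ [_ [x ->] <-]; rewrite setTI; apply: sub_sigma_algebra.
by apply: open_comp => [t _|]; [exact: cf|exact: interval_open].
Qed.

Lemma continuous_curve_measurable_borel (X : ptopologicalType) (f : R -> X) :
  continuous f ->
  measurable_fun setT (f : R -> g_sigma_algebraType (@open X)).
Proof.
move=> cf; apply: (@measurability _ _ _ (g_sigma_algebraType (@open X)) setT f (@open X)).
  by [].
move=> _ [U oU <-]; rewrite setTI; apply: open_measurable.
by apply: open_comp => [t _|//]; exact: cf.
Qed.

End measurability.

Section kernel_energy.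
Context {R : realType} {K : fieldType} (v : absvalue R K).
Variables (H : P1berk v -> P1berk v -> R) (H_can : is_can_kernel H).
Variables (g : P1berk v -> R) (g_cont : continuous g).

Lemma measurable_Phi (S : P1berk v) :
  measurable_fun setT (Phi H g S : P1borel v -> \bar R).
Proof.
have [_ _ cH _] := H_can.
apply: emeasurable_funB; last first.
  by apply/measurable_EFinP; exact: continuous_measurable_borel.
apply: emeasurable_funB => //.
apply: (measurableT_comp measurable_lne_EFin).
exact: continuous_measurable_borel.
Qed.

(** By separate continuity of the kernel, [H x (gam t)] is Borel in [x] and continuous in [t]; this
    gives measurability for the product of the sigma-algebras. *)
Lemma measurable_Phi_curve (gam : R -> P1berk v) : continuous gam ->
  measurable_fun setT (fun z : P1borel v * R => Phi H g z.1 (gam z.2)).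
Proof.
have [_ _ cH cH'] := H_can => cgam.
have mg : measurable_fun setT (g : P1borel v -> R).
  exact: continuous_measurable_borel.
apply: emeasurable_funB; last first.
  apply/measurable_EFinP; apply: (measurableT_comp mg).
  apply: (@measurableT_comp _ _ _ _ _ _ (gam : R -> P1borel v)) => //.
  exact: continuous_curve_measurable_borel.
apply: emeasurable_funB.
  apply: (measurableT_comp measurable_lne_EFin).
  apply: (@measurable_caratheodory _ _ _ (fun (x : P1borel v) t => H x (gam t))).
    by move=> t; apply: continuous_measurable_borel; exact: cH'.
  by move=> x t; apply: continuous_comp; [exact: cgam|exact: cH].
by apply/measurable_EFinP; apply: (measurableT_comp mg).
Qed.

End kernel_energy.

(** * The uniform law and Radon measures on the Berkovich line *)

Section uniform_probability.
Variable R : realType.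
Definition unit_prob : probability (measurableTypeR R) R := uniform_prob (@ltr01 R).
Lemma integral_unit_prob (f : R -> \bar R) :
  measurable_fun setT f -> (forall x, 0 <= f x)%E ->
  (\int[unit_prob]_x f x = \int[lebesgue_measure]_(x in `[0%R, 1%R]) f x)%E.
Proof. by move=> mf f0; rewrite /unit_prob integral_uniform// subr0 invr1 mul1e. Qed.

Lemma unit_prob_lebesgue (A : set R) : measurable A ->
  unit_prob A = lebesgue_measure (A `&` `[0, 1]).
Proof.
move=> mA.
have := @integral_indic _ _ _ unit_prob _ measurableT _ mA; rewrite setIT => <-.
rewrite integral_unit_prob//.
  by rewrite integral_indic.
by apply/measurable_EFinP; exact: measurable_indic.
Qed.

(** Inner regularity of the Lebesgue measure is applied to the part of [A] in the unit interval,
    whose measure is finite. *)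
Lemma unit_prob_inner_regular (A : set R) (e : R) : measurable A -> 0 < e ->
  exists V, [/\ compact V, V `<=` A & (unit_prob A <= unit_prob V + e%:E)%E].
Proof.
move=> mA e0.
have mA1 : measurable (A `&` `[0%R, 1%R]) by exact: measurableI.
have fin : (lebesgue_measure (A `&` `[0%R, 1%R]%classic) < +oo)%E.
  rewrite -unit_prob_lebesgue//.
  exact: le_lt_trans (probability_le1 unit_prob mA) (ltry _).
have [V [cV VA VAe]] := lebesgue_regularity_inner mA1 fin e0.
have mV : measurable V by exact: compact_measurable.
exists V; split => //; first by move=> x /VA[].
rewrite !unit_prob_lebesgue//.
rewrite (_ : V `&` _ = V); last by apply/setIidPl => x /VA[].
rewrite -{1}(setDKU VA) setUC (le_trans (@outer_measureU2 _ _ _ _ _))//.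
by rewrite leeD2l// ltW.
Qed.

End uniform_probability.

Section berkovich_topology.
Context {R : realType} {K : fieldType} (v : absvalue R K).

Lemma A1berk_eval_continuous (f : {poly K}) : continuous (fun x : A1berk v => x f).
Proof.
move=> x.
apply: (@continuous_comp _ _ _ (@seminorm R K v : A1berk v -> prod_topology (fun _ : {poly K} => R)) (@proj _ (fun _ : {poly K} => R) f)).
  exact: initial_continuous.
exact: proj_continuous.
Qed.

Lemma A1berk_hausdorff : hausdorff_space (A1berk v).
Proof.
move=> x y xy; suff : seminorm x = seminorm y.
  case: x y {xy} => [x px] [y py] /= xy; subst y.
  by congr A1Berk; exact: Prop_irrelevance.
apply/funext => f; apply: (@Rhausdorff R) => A B nA nB.
have [z [Az Bz]] := xy _ _ (A1berk_eval_continuous nA) (A1berk_eval_continuous nB).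
by exists (z f).
Qed.

Lemma continuous_A1berk (T : topologicalType) (gam : T -> A1berk v) :
  (forall f, continuous (fun t => gam t f)) -> continuous gam.
Proof.
move=> cg; apply: continuous_comp_initial => t.
apply/cvg_sup => f; apply: continuous_comp_initial; exact: cg.
Qed.

(** The complement of a closed compact set is a basic neighbourhood of infinity, and compact sets of
    the Hausdorff affine line are closed. *)
Lemma compact_closed_Some (C : set (A1berk v)) : compact C ->
  compact (Some @` C : set (P1berk v)) /\ closed (Some @` C : set (P1berk v)).
Proof.
move=> cC; have clC := compact_closed A1berk_hausdorff cC; split.
  apply: continuous_compact => //; apply: continuous_subspaceT.
  exact: one_point_compactification_some_continuous.
rewrite -openC openE => -[x|] /= xC.
  have : nbhs x (~` C).
    apply: open_nbhs_nbhs; split; first exact: closed_openC.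
    by move=> Cx; apply: xC; exists x.
  by apply: filterS => y yC [z Cz [zy]]; apply: yC; rewrite -zy.
exists C => // -[y|] [|]//.
  by move=> [z zC [<-]] [w Cw [wz]]; apply: zC; rewrite -wz.
Qed.


(** Choose nearly full compact sets of parameters in the preimages of [A]. The union of their images
    is compact, lies in [A], and is closed because the curves stay in the affine line. *)
Lemma radon_pushforward_average n
    (gam : nat -> {mfun measurableTypeR R >-> P1borel v})
    (del : nat -> R -> A1berk v) :
  (forall i, continuous (del i)) -> (forall i t, gam i t = Some (del i t)) ->
  radon (pushforward_average (unit_prob R) n gam : probability _ _).
Proof.
move=> cdel gamE A mA; apply/eqP; rewrite eq_le; apply/andP; split; last first.
  apply: ge_ereal_sup => _ [C [_ [clC CA]] <-]; apply: le_measure; rewrite ?inE//.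
  rewrite -(setCK C); apply: measurableC.
  by apply: sub_sigma_algebra; exact: closed_openC.
apply/lee_addgt0Pr => e e0.
have mgA i : measurable (gam i @^-1` A).
  by rewrite -[X in measurable X]setTI; exact: measurable_funP.
have /choice[V VP] i := unit_prob_inner_regular (mgA i) e0.
pose C : set (A1berk v) := \big[setU/set0]_(i < n.+1) (del i @` V i).
have cC : compact C.
  apply: bigsetU_compact => i _; apply: continuous_compact; last by case: (VP i).
  by apply: continuous_subspaceT; exact: cdel.
have [cSC clSC] := compact_closed_Some cC.
apply: (@le_trans _ _ (pushforward_average (unit_prob R) n gam (Some @` C) + e%:E)%E).
  rewrite /pushforward_average /mscale/= /msum.
  rewrite (_ : e%:E = (n.+1%:R^-1)%:E * \sum_(i < n.+1) e%:E)%E; last first.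
    by rewrite sumEFin sumr_const card_ord -(mulr_natl e) -EFinM mulKf.
  rewrite -ge0_muleDr; last 2 first.
  - exact: sume_ge0.
  - by apply: sume_ge0 => i _; rewrite lee_fin ltW.
  apply: lee_wpmul2l; first by rewrite lee_fin.
  rewrite -big_split/=; apply: lee_sum => i _.
  have [cV VA AV] := VP i; apply: (le_trans AV); rewrite leeD2r//.
  apply: le_measure; rewrite ?inE.
  - exact: compact_measurable.
  - rewrite -[X in measurable X]setTI; apply: measurable_funP => //.
    rewrite -(setCK (Some @` C)); apply: measurableC.
    by apply: sub_sigma_algebra; exact: closed_openC.
  - move=> t Vt /=; exists (del i t); last by rewrite gamE.
    by rewrite /C (bigD1 i)//=; left; exists t.
rewrite leeD2r//; apply: ereal_sup_ubound; exists (Some @` C) => //; split => //; split => //.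
move=> _ [x Cx <-]; move: Cx; rewrite /C -(bigcup_mkord n.+1 (fun i => del i @` V i)) => -[i _ [t Vt <-]].
by have [_ VA _] := VP i; rewrite -gamE; exact: VA.
Qed.

End berkovich_topology.

(** * The energy of the regularized configuration *)

Section regularized_energy.
Context {R : realType} {K : fieldType} (v : absvalue R K).
Variables (H : P1berk v -> P1berk v -> R) (H_can : is_can_kernel H).
Variables (g : P1berk v -> R) (g_cont : continuous g).
Local Notation P := (unit_prob R).

Lemma continuous_P1berk_bounded : exists2 G : R, 0 <= G & forall S, `|g S| <= G.
Proof.
have cng : {within [set: P1berk v], continuous (fun S => `|g S|)}.
  apply: continuous_subspaceT => S; apply: continuous_comp; first exact: g_cont.
  exact: norm_continuous.
have /compact_bounded := continuous_compact cng (@one_point_compactification_compact _).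
move=> [M [_ /(_ (Num.max M 0 + 1))]] bM.
exists (Num.max M 0 + 1); first by rewrite addr_ge0// le_max lexx orbT.
move=> S; rewrite -[leLHS]normr_id; apply: bM; last by exists S.
by rewrite (@le_lt_trans _ _ (Num.max M 0))// ?le_max ?lexx// ltrDl.
Qed.

Variables (n : nat) (z : nat -> P1 K) (del : nat -> R -> A1berk v).
Variables (s c eta : R).
Hypothesis del_cont : forall i, continuous (del i).
Let gam i t : P1berk v := Some (del i t).

(** Here [gam i] replaces [z i], [s] is the radius and [eta] bounds the increase of [g]. Replacing
    one point of a pair by its curve costs [ln c]; an off-diagonal pair pays this twice, once in
    each stage of the double integral. The sum is a lower bound for the energy multiplied by the
    square of the number of points. *)
Lemma regularized_energy_le0 :
  equilibrium_energy H g = 0%E -> 0 < c <= 1 ->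
  (forall i t, (i <= n)%N -> g (gam i t) <= g (typeI v (z i)) + eta) ->
  (forall i j t u, (i <= n)%N -> (j <= n)%N -> H (gam i t) (gam j u) <= 1) ->
  (forall i j t, (i <= n)%N -> (j <= n)%N -> H (gam i t) (typeI v (z j)) <= 1) ->
  (forall i t, (i <= n)%N ->
    ((ln (c * s))%:E <= \int[P]_u lne (H (gam i t) (gam i u))%:E)%E) ->
  (forall i j t, (i <= n)%N -> (j <= n)%N -> i != j ->
    ((ln c)%:E + lne (H (gam i t) (typeI v (z j)))%:E <=
     \int[P]_u lne (H (gam i t) (gam j u))%:E)%E) ->
  (forall i j, (i <= n)%N -> (j <= n)%N -> i != j ->
    ((ln c + ln (chordal v (z i) (z j)))%:E <=
     \int[P]_t lne (H (gam i t) (typeI v (z j)))%:E)%E) ->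
  \sum_(i < n.+1) \sum_(j < n.+1)
    ((if i == j then ln (c * s) else 2 * ln c + ln (chordal v (z i) (z j)))
     - g (typeI v (z i)) - g (typeI v (z j)) - 2 * eta) <= 0.
Proof.
move=> V0 /andP[c0 c1] geta Hgg Hgz diag off1 off2.
have cgam i : continuous (gam i).
  by move=> t; apply: continuous_comp; [exact: del_cont|
    exact: one_point_compactification_some_continuous].
have mgam i : measurable_fun setT (gam i : measurableTypeR R -> P1borel v).
  exact: continuous_curve_measurable_borel.
pose Gam i : {mfun measurableTypeR R >-> P1borel v} :=
  HB.pack (gam i : measurableTypeR R -> P1borel v)
    (isMeasurableFun.Build _ _ _ _ _ (mgam i)).
pose nu : probability (P1borel v) R := pushforward_average P n Gam.
have nu_radon : radon nu by apply: radon_pushforward_average => //; exact: del_cont.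
have : (energy H g nu <= 0)%E.
  by rewrite -V0; apply: ereal_sup_ubound; exists nu.
have [G G0 gG] := continuous_P1berk_bounded.
have gG' S : - G <= g S <= G by rewrite -ler_norml.
(* By [geta], [k i j] is a lower bound for the contribution of [g] to [Phi] on the curves [i] and
   [j]. *)
pose k i j := - g (typeI v (z i)) - g (typeI v (z j)) - 2 * eta.
pose b i j (t : measurableTypeR R) : \bar R := if i == j then (ln (c * s) + k i j)%:E
  else (lne (H (gam i t) (typeI v (z j)))%:E + (ln c + k i j)%:E)%E.
pose D i j := (if i == j then ln (c * s) else 2 * ln c + ln (chordal v (z i) (z j)))
  + k i j.
(* A crude bound that dominates both [Phi] on the curves and all the [b i j], the logarithms of the
   kernel being at most 0. *)
pose M := 2 * G + 2 * `|eta| + `|ln (c * s)| + 2 * G.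
have lnc0 : ln c <= 0 by exact: ln_le0.
have kM i j : k i j <= 2 * G + 2 * `|eta|.
  have := ler_norm (- eta); rewrite normrN /k.
  by have := gG' (typeI v (z i)); have := gG' (typeI v (z j)); lra.
have [_ _ cH cH'] := H_can.
have mHz i j : measurable_fun setT
    (fun t : measurableTypeR R => lne (H (gam i t) (typeI v (z j)))%:E).
  apply: (measurableT_comp measurable_lne_EFin).
  exact: measurableT_comp (continuous_measurable_borel (cH' _)) (mgam i).
have mHg (S : P1berk v) j : measurable_fun setT
    (fun t : measurableTypeR R => lne (H S (gam j t))%:E).
  apply: (measurableT_comp measurable_lne_EFin).
  exact: measurableT_comp (continuous_measurable_borel (cH S)) (mgam j).
suff : (((n.+1%:R^-1) ^+ 2 * \sum_(i < n.+1) \sum_(j < n.+1) D i j)%R%:E <=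
       energy H g nu)%E.
  move=> /le_trans /[apply]; rewrite lee_fin pmulr_rle0 ?exprn_gt0 ?invr_gt0//.
  apply: le_trans; rewrite le_eqVlt; apply/orP; left; apply/eqP.
  by apply: eq_bigr => i _; apply: eq_bigr => j _; rewrite /D /k !addrA.
apply: (@le_double_integral_pushforward_average _ _ _ _ _ P n Gam M (Phi H g) b).
- by move=> S; exact: measurable_Phi.
- by move=> i; exact: (measurable_Phi_curve H_can g_cont (cgam i)).
- move=> i j t u ni nj; rewrite /Phi -addeA -EFinN -EFinN -EFinD.
  apply: (@le_trans _ _ (0 + (- g (gam i t) - g (gam j u))%:E)%E).
    by rewrite leeD2r// lne_le0 lee_fin; exact: Hgg.
  rewrite add0e lee_fin /M.
  have := gG' (gam i t); have := gG' (gam j u).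
  by have := normr_ge0 eta; have := normr_ge0 (ln (c * s)); lra.
- move=> i j; rewrite /b; case: eqP => _; first exact: measurable_cst.
  exact: emeasurable_funD.
- move=> i j t ni nj; rewrite /b /M; case: eqP => _.
    by rewrite lee_fin; have := kM i j; have := ler_norm (ln (c * s)); lra.
  apply: (@le_trans _ _ (0 + (ln c + k i j)%:E)%E).
    by rewrite leeD2r// lne_le0 lee_fin; exact: Hgz.
  rewrite add0e lee_fin; have := kM i j.
  by have := normr_ge0 eta; have := normr_ge0 (ln (c * s)); lra.
- move=> i j t ni nj.
  apply: (@le_trans _ _ (\int[P]_u (lne (H (gam i t) (gam j u))%:E + (k i j)%:E))%E).
    apply: le_trans (@le_integral_shift _ _ _ P 0 (k i j) _ (mHg _ _) _); last first.
      by move=> u; rewrite lne_le0 lee_fin; exact: Hgg.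
    rewrite /b; case: eqVneq => [<-|ij].
      by rewrite EFinD leeD2r//; exact: diag.
    by rewrite EFinD addeA leeD2r// addeC; exact: off1.
  apply: le_integral_measurable.
  + exact: emeasurable_funD.
  + exact: measurableT_comp (measurable_Phi H_can g_cont _) (mgam j).
  + move=> u; rewrite /Phi -addeA -EFinN -EFinN -EFinD leeD2l// lee_fin /k.
    by have := geta i t ni; have := geta j u nj; lra.
- move=> i j ni nj; rewrite /b /D; case: eqVneq => [<-|ij].
    by rewrite integral_cst//= probability_setT mule1.
  apply: le_trans (@le_integral_shift _ _ _ P 0 (ln c + k i j) _ (mHz _ _) _); last first.
    by move=> u; rewrite lne_le0 lee_fin; exact: Hgz.
  rewrite [X in (X%:E <= _)%E](_ : _ = ln c + ln (chordal v (z i) (z j)) + (ln c + k i j));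
    last by lra.
  by rewrite EFinD leeD2r//; exact: off2.
Qed.

End regularized_energy.

(** * Chordal metric and non-archimedean disks *)

Section absvalue_theory.
Context {R : realType} {K : fieldType} (v : absvalue R K).

Lemma absv0 : v 0 = 0.
Proof. by apply/eqP; rewrite absv_eq0. Qed.

Lemma absv_gt0 x : (0 < v x) = (x != 0).
Proof. by rewrite lt0r absv_ge0 andbT absv_eq0. Qed.

Lemma absv1 : v 1 = 1.
Proof.
have v1 : v 1 != 0 by rewrite absv_eq0 oner_neq0.
by apply: (mulfI v1); rewrite -absvM !mulr1.
Qed.

Lemma absvN x : v (- x) = v x.
Proof.
rewrite -mulN1r absvM [X in X * _](_ : _ = 1) ?mul1r//.
apply/eqP; rewrite -(@eqrXn2 _ 2)//; last exact: absv_ge0.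
by rewrite expr1n expr2 -absvM mulrNN mulr1 absv1.
Qed.

Lemma absvB x y : v (x - y) = v (y - x).
Proof. by rewrite -opprB absvN. Qed.

Lemma absvV x : v x^-1 = (v x)^-1.
Proof.
have [->|x0] := eqVneq x 0; first by rewrite invr0 absv0 invr0.
by apply: (mulfI (_ : v x != 0)); rewrite ?absv_eq0// -absvM !mulfV ?absv1// absv_eq0.
Qed.

Lemma absvX x n : v (x ^+ n) = v x ^+ n.
Proof. by elim: n => [|n IH]; rewrite ?expr0 ?absv1// !exprS absvM IH. Qed.

Lemma absv_prod (I : Type) (r : seq I) (P : pred I) (F : I -> K) :
  v (\prod_(i <- r | P i) F i) = \prod_(i <- r | P i) v (F i).
Proof. exact: (big_morph (absv v) (absvM v) absv1). Qed.

Lemma norm2_ge0 p : 0 <= norm2 v p.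
Proof. by rewrite /norm2; case: ifP => _; rewrite ?sqrtr_ge0// le_max absv_ge0. Qed.

Lemma norm2_lift_gt0 z : 0 < norm2 v (Defs.lift z).
Proof.
rewrite /norm2; case: ifP => _.
  by case: z => [x|]; rewrite /= lt_max absv1 ltr01 ?orbT.
by case: z => [x|]; rewrite sqrtr_gt0 /= absv1 expr1n ?absv0;
  rewrite ?expr0n/= ?add0r// ltr_pwDl// sqr_ge0.
Qed.

Lemma norm2Z a p : norm2 v (a * p.1, a * p.2) = v a * norm2 v p.
Proof.
rewrite /norm2; case: ifP => _ /=; rewrite !absvM.
  by rewrite maxr_pMr ?absv_ge0.
by rewrite !exprMn -mulrDr sqrtrM ?sqr_ge0// sqrtr_sqr ger0_norm// absv_ge0.
Qed.

Definition det2 (p q : K * K) : K := p.1 * q.2 - p.2 * q.1.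

(** The chordal metric can be computed from any homogeneous coordinates, since the scalars cancel.
    This allows lifts other than the normalized ones. *)
Lemma chordal_homogeneous z w a b p q : a != 0 -> b != 0 ->
  Defs.lift z = (a * p.1, a * p.2) -> Defs.lift w = (b * q.1, b * q.2) ->
  chordal v z w = v (det2 p q) / (norm2 v p * norm2 v q).
Proof.
move=> a0 b0 zE wE; rewrite /chordal zE wE !norm2Z /=.
rewrite (_ : _ - _ = (a * b) * det2 p q); last by rewrite /det2; ring.
rewrite !absvM mulrACA -mulf_div divff ?mul1r//.
by rewrite mulf_neq0// absv_eq0.
Qed.

Lemma chordalC z w : chordal v z w = chordal v w z.
Proof.
rewrite /chordal absvB (mulrC (norm2 _ _)); congr (v _ / _).
by rewrite (mulrC (Defs.lift w).1) (mulrC (Defs.lift w).2).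
Qed.

Lemma chordalxx z : chordal v z z = 0.
Proof. by rewrite /chordal (mulrC (Defs.lift z).2) subrr absv0 mul0r. Qed.

Lemma chordal_ge0 z w : 0 <= chordal v z w.
Proof. by rewrite /chordal divr_ge0 ?absv_ge0// mulr_ge0 ?norm2_ge0. Qed.

Lemma chordal_gt0 z w : z != w -> 0 < chordal v z w.
Proof.
move=> zw; rewrite /chordal divr_gt0 ?mulr_gt0 ?norm2_lift_gt0// absv_gt0.
case: z w zw => [x|] [y|] //= zw; rewrite ?mul0r ?mul1r ?mulr1 ?mulr0 ?subr0 ?sub0r ?oppr_eq0 ?oner_neq0//.
by rewrite subr_eq0 eq_sym; apply: contra zw => /eqP ->.
Qed.

Definition P1_inv (z : P1 K) : P1 K :=
  if z is Some x then if x == 0 then None else Some x^-1 else Some 0.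

Lemma lift_P1_inv z : exists2 a, a != 0 &
  Defs.lift (P1_inv z) = (a * ((Defs.lift z).2, (Defs.lift z).1).1, a * ((Defs.lift z).2, (Defs.lift z).1).2).
Proof.
case: z => [x|] /=; last by exists 1; rewrite ?oner_neq0// !mul1r.
have [->|x0] := eqVneq x 0; first by exists 1; rewrite ?oner_neq0// !mul1r.
by exists x^-1; rewrite ?invr_eq0// mulVf// mulr1.
Qed.

(** Swapping the two coordinates only changes the sign of the determinant, and the norm is
    symmetric. This isometry moves points outside the unit disk into it. *)
Lemma chordal_P1_inv z w : chordal v (P1_inv z) (P1_inv w) = chordal v z w.
Proof.
have [a a0 aE] := lift_P1_inv z; have [b b0 bE] := lift_P1_inv w.
rewrite (chordal_homogeneous a0 b0 aE bE) /chordal /det2 /= absvB.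
by congr (_ / (_ * _)); rewrite /norm2/= maxC addrC.
Qed.

End absvalue_theory.

(** * Ultrametric geometry and equidistant points *)

Section nonarchimedean_field.
Context {R : realType} {K : closedFieldType} (v : absvalue R K).
Hypothesis v_na : nonarchimedean v.

Lemma norm2_max p : norm2 v p = Num.max (v p.1) (v p.2).
Proof. by rewrite /norm2 asboolT. Qed.

Lemma absv_le_sub x y : v x <= Num.max (v y) (v (x - y)).
Proof. by rewrite -{1}(subrK y x) maxC v_na. Qed.

Lemma chordal_le1_na z w : chordal v z w <= 1.
Proof.
rewrite /chordal ler_pdivrMr ?mulr_gt0 ?norm2_lift_gt0// mul1r.
apply: (le_trans (v_na _ _)); rewrite absvN !absvM !norm2_max ge_max.
by rewrite !ler_pM ?absv_ge0 ?le_max ?lexx ?orbT.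
Qed.

(* The Pluecker relation [det(p, r) q = det(q, r) p + det(p, q) r]. *)
Lemma chordal_ultrametric z w u :
  chordal v z u <= Num.max (chordal v z w) (chordal v w u).
Proof.
have p0 := norm2_lift_gt0 v z; have q0 := norm2_lift_gt0 v w.
have r0 := norm2_lift_gt0 v u.
rewrite /chordal; set p := Defs.lift z; set q := Defs.lift w; set r := Defs.lift u.
rewrite -/p -/q -/r in p0 q0 r0.
rewrite -!/(det2 _ _).
have key (a b c : K) : det2 p r * a = det2 q r * b + det2 p q * c ->
    v (det2 p r) * v a <= Num.max (v (det2 q r) * v b) (v (det2 p q) * v c).
  by move=> E; rewrite -!absvM E v_na.
have k1 := key q.1 p.1 r.1; have k2 := key q.2 p.2 r.2.
have pq : v (det2 p r) * norm2 v q <=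
    Num.max (v (det2 q r) * norm2 v p) (v (det2 p q) * norm2 v r).
  rewrite {1}norm2_max maxr_pMr ?absv_ge0// ge_max; apply/andP; split.
    apply: (le_trans (k1 _)); first by rewrite /det2; ring.
    by rewrite ge_max !le_max !norm2_max !ler_wpM2l ?absv_ge0 ?le_max ?lexx ?orbT.
  apply: (le_trans (k2 _)); first by rewrite /det2; ring.
  by rewrite ge_max !le_max !norm2_max !ler_wpM2l ?absv_ge0 ?le_max ?lexx ?orbT.
have -> : v (det2 p r) / (norm2 v p * norm2 v r) =
   (v (det2 p r) * norm2 v q) / (norm2 v p * norm2 v q * norm2 v r).
  by field; rewrite !lt0r_neq0.
have -> : v (det2 p q) / (norm2 v p * norm2 v q) =
   (v (det2 p q) * norm2 v r) / (norm2 v p * norm2 v q * norm2 v r).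
  by field; rewrite !lt0r_neq0.
have -> : v (det2 q r) / (norm2 v q * norm2 v r) =
   (v (det2 q r) * norm2 v p) / (norm2 v p * norm2 v q * norm2 v r).
  by field; rewrite !lt0r_neq0.
rewrite le_max !ler_pM2r ?invr_gt0 ?mulr_gt0//.
by move: pq; rewrite le_max orbC.
Qed.

(* A root [u] of [prod (X - a) - 1] has [v (u - a) = 1] for every [a]. *)
Lemma residue_class_avoiding (l : seq K) : (0 < size l)%N ->
  (forall a, a \in l -> v a <= 1) ->
  exists u, v u <= 1 /\ forall a, a \in l -> v (u - a) = 1.
Proof.
move=> l0 vl.
pose p := \prod_(a <- l) ('X - a%:P) - 1 : {poly K}.
have /closed_rootP[u] : size p != 1%N.
  rewrite /p size_polyDl ?size_prod_XsubC; first by case: l l0 {vl p}.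
  by rewrite size_polyN size_poly1; case: l l0 {vl p}.
rewrite /root /p hornerD hornerN hornerC horner_prod subr_eq0 => /eqP pu.
have {}pu : \prod_(a <- l) v (u - a) = 1.
  rewrite -absv_prod (eq_bigr (fun a => ('X - a%:P).[u])) ?pu ?absv1//.
  by move=> a _; rewrite !hornerE.
have u1 : v u <= 1.
  (* If [v u] exceeded 1, then so would every factor [v (u - a)], and the product could not be 1. *)
  rewrite leNgt; apply/negP => u1.
  have ua a : a \in l -> v u <= v (u - a).
    move=> al; have := absv_le_sub u a; rewrite le_max => /orP[|//].
    by move=> /(lt_le_trans u1); rewrite ltNge vl.
  suff : 1 < \prod_(a <- l) v (u - a) by rewrite pu ltxx.
  apply: (@lt_le_trans _ _ (\prod_(a <- l) v u)).
    by rewrite big_const_seq count_predT iter_mulr_1 exprn_egt1// -lt0n.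
  by rewrite big_seq [leRHS]big_seq; apply: ler_prod => a al; rewrite absv_ge0 ua.
exists u; split=> // a al.
have F1 b : b \in l -> v (u - b) <= 1.
  by move=> bl; apply: le_trans (v_na _ _) _; rewrite absvN ge_max u1 vl.
(* A product of factors at most 1 is at most any one of them; as it equals 1, each factor is 1. *)
apply/eqP; rewrite eq_le F1//= -{1}pu (big_rem a)//= ler_piMr ?absv_ge0//.
rewrite big_seq; apply: prodr_ile1 => b /mem_rem bl.
by rewrite absv_ge0 F1.
Qed.

(** Each new element is chosen to avoid the residue classes of all earlier ones. *)
Lemma residue_classes_infinite : exists u : nat -> K,
  (forall k, v (u k) = 1) /\ (forall k l, k != l -> v (u k - u l) = 1).
Proof.
have /choice[f fP] (l : seq K) : exists u, (0 < size l)%N ->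
    (forall a, a \in l -> v a <= 1) ->
    v u <= 1 /\ forall a, a \in l -> v (u - a) = 1.
  have [l0|l0] := posnP (size l); first by exists 0.
  have [vl|vl] := pselect (forall a, a \in l -> v a <= 1); last by exists 0.
  by have [u] := residue_class_avoiding l0 vl; exists u.
(* Starting the list with 0 forces [v (u k) = v (u k - 0) = 1]. *)
pose L := fix L k := if k is k'.+1 then f (L k') :: L k' else [:: 0 : K].
have L0 k : (0 < size (L k))%N by case: k.
have Lv k a : a \in L k -> v a <= 1.
  elim: k a => [|k IH] a /=; first by rewrite inE => /eqP ->; rewrite absv0.
  by rewrite inE => /predU1P[->|/IH//]; have [] := fP _ (L0 k) (IH).
have fL k := fP _ (L0 k) (Lv k).
have L0' k : 0 \in L k by elim: k => [|k IH] /=; rewrite inE ?eqxx ?IH ?orbT.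
have Lm k m : (k < m)%N -> f (L k) \in L m.
  elim: m => // m IH; rewrite ltnS leq_eqVlt => /predU1P[->|/IH] /=;
    by rewrite inE ?eqxx// => ->; rewrite orbT.
exists (fun k => f (L k)); split=> [k|k l].
  by have [_ /(_ _ (L0' k))] := fL k; rewrite subr0.
wlog kl : k l / (k < l)%N.
  by rewrite neq_ltn => h /orP[kl|lk]; [|rewrite absvB]; apply: h => //; rewrite ltn_eqF.
by move=> _; rewrite absvB; apply: (fL l).2; exact: Lm.
Qed.

(** A root [t] of high order of an element of absolute value above 1 satisfies [1 < v t <= d].
    Consecutive powers of [t] then differ by a factor of at most [d], so one of them falls into the
    window. *)
Lemma value_group_dense (e d : R) : nontrivial_abs v -> 0 < e -> 1 < d ->
  exists b : K, e / d <= v b <= e.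
Proof.
move=> [y0 [y00 vy01]] e0 d1.
have [y vy] : exists y, 1 < v y.
  have [y01|y01] := ltP (v y0) 1.
    by exists y0^-1; rewrite absvV invf_gt1// absv_gt0.
  by exists y0; rewrite lt_neqAle eq_sym vy01.
have d0 : 0 < d by rewrite (lt_trans ltr01).
have [N vyN] : exists N, v y <= d ^+ N.+1.
  have ld : 0 < ln d by rewrite ln_gt0.
  exists (Num.truncn (ln (v y) / ln d)).
  rewrite -ler_ln ?posrE ?exprn_gt0//; last by rewrite (lt_trans ltr01).
  rewrite lnXn// -mulr_natl -ler_pdivrMr// ltW// truncnS_gt//.
have /closed_rootP[t] : size ('X^(N.+1) - y%:P) != 1%N.
  by rewrite size_XnsubC.
rewrite /root !hornerE subr_eq0 => /eqP tN.
have vt : v t ^+ N.+1 = v y by rewrite -absvX tN.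
have t1 : 1 < v t.
  rewrite ltNge; apply/negP => t1; move: vy; rewrite -vt ltNge exprn_ile1//.
  exact: absv_ge0.
have td : v t <= d.
  by rewrite -(@ler_pXn2r _ N.+1)// ?nnegrE ?absv_ge0 ?(ltW d0)// vt.
have t0 : 0 < v t by rewrite (lt_trans ltr01).
have lt0 : 0 < ln (v t) by rewrite ln_gt0.
(* The largest exponent for which the power of [v t] does not exceed [e]. *)
pose m : int := Num.floor (ln e / ln (v t)).
have powE (k : int) : v (t ^ k) = expR (k%:~R * ln (v t)).
  case: k => k; rewrite ?NegzE.
    by rewrite -exprnP absvX expRM_natl lnK.
  by rewrite -exprnN absvV absvX mulrNz mulNr expRN expRM_natl lnK.
exists (t ^ m); rewrite powE; apply/andP; split.
  rewrite ler_pdivrMr//; apply: (@le_trans _ _ (expR (m%:~R * ln (v t)) * v t)); last first.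
    by rewrite ler_pM2l// expR_gt0.
  rewrite -{2}(lnK (_ : v t \is Num.pos))// -expRD -{1}(lnK (_ : e \is Num.pos))//.
  rewrite ler_expR -[X in _ + X]mul1r -mulrDl -ler_pdivrMr//.
  by rewrite -[1]/(1%:~R) -intrD ltW// floorD1_gt.
rewrite -[leRHS](lnK (_ : e \is Num.pos))// ler_expR -ler_pdivlMr//.
exact: floor_le.
Qed.


Lemma chordal_unit_disk x y : v x <= 1 -> v y <= 1 ->
  chordal v (Some x) (Some y) = v (x - y).
Proof.
move=> x1 y1; rewrite /chordal /= !norm2_max/= absv1 !(max_idPl _)//.
by rewrite !mulr1 divr1 mul1r absvB.
Qed.

(** Around a point [x] of the unit disk the points [x + b * u k] work, the [u k] lying in distinct
    nonzero residue classes. The inversion carries this to the other points. *)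
Lemma equidistant_sequence z b : v b <= 1 -> exists w : nat -> P1 K,
  (forall k, chordal v z (w k) = v b) /\
  (forall k l, k != l -> chordal v (w k) (w l) = v b).
Proof.
move=> b1; have [u [u1 ukl]] := residue_classes_infinite.
have bu k : v (b * u k) <= 1 by rewrite absvM u1 mulr1.
have disk x : v x <= 1 -> exists w : nat -> P1 K,
    (forall k, chordal v (Some x) (w k) = v b) /\
    (forall k l, k != l -> chordal v (w k) (w l) = v b).
  move=> x1; have xbu k : v (x + b * u k) <= 1.
    by rewrite (le_trans (v_na _ _))// ge_max x1 bu.
  exists (fun k => Some (x + b * u k)); split=> [k|k l kl].
    rewrite chordal_unit_disk// (_ : _ - _ = - (b * u k)); last by ring.
    by rewrite absvN absvM u1 mulr1.
  rewrite chordal_unit_disk// (_ : _ - _ = b * (u k - u l)); last by ring.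
  by rewrite absvM ukl// mulr1.
have inv y : v y <= 1 -> z = P1_inv (Some y) -> exists w : nat -> P1 K,
    (forall k, chordal v z (w k) = v b) /\
    (forall k l, k != l -> chordal v (w k) (w l) = v b).
  move=> y1 ->; have [w [w1 w2]] := disk y y1.
  exists (fun k => P1_inv (w k)); split=> [k|k l kl].
    by rewrite chordal_P1_inv.
  by rewrite chordal_P1_inv w2.
case: z inv => [x|] inv; last first.
  by apply: (inv 0); rewrite ?absv0// /P1_inv eqxx.
have [x1|x1] := leP (v x) 1; first exact: disk.
have x0 : x != 0 by rewrite -(absv_gt0 v) (lt_trans ltr01).
apply: (inv x^-1); first by rewrite absvV invf_le1 ?ltW// absv_gt0.
by rewrite /P1_inv invr_eq0 (negbTE x0) invrK.
Qed.

(** If [y] is farther than [s] from [z], every triangle [z], [w k], [y] is isosceles. Otherwise at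
    most one [w k] is closer than [s] to [y], since two such points would be closer than [s] to each
    other. *)
Lemma equidistant_chordal z s (w : nat -> P1 K) :
  (forall k, chordal v z (w k) = s) ->
  (forall k l, k != l -> chordal v (w k) (w l) = s) ->
  forall y, exists k0, forall k, (k0 <= k)%N ->
    chordal v (w k) y = Num.max s (chordal v z y).
Proof.
move=> zw ww y.
have wy k : chordal v (w k) y <= Num.max s (chordal v z y).
  by rewrite (le_trans (chordal_ultrametric _ z _))// chordalC zw.
have [zys|szy] := leP (chordal v z y) s; last first.
  exists 0%N => k _; apply/eqP; rewrite eq_le.
  have := wy k; rewrite (max_idPr (ltW szy)) => -> /=.
  by have := chordal_ultrametric z (w k) y; rewrite zw le_max leNgt szy.
have [[k1 k1s]|nk1] := pselect (exists k1, chordal v (w k1) y < s).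
  (* Starting after [k1] leaves out the exceptional index. *)
  exists k1.+1 => k kk1; apply/eqP; rewrite eq_le.
  have := wy k; rewrite (max_idPl zys) => -> /=.
  have := chordal_ultrametric (w k) y (w k1).
  rewrite ww ?gtn_eqF// le_max (chordalC v y) [X in _ || X]leNgt k1s orbF//.
exists 0%N => k _; apply/eqP; rewrite eq_le.
have := wy k; rewrite (max_idPl zys) => -> /=.
by rewrite leNgt; apply/negP => ks; apply: nk1; exists k.
Qed.

End nonarchimedean_field.

(** * The kernel at cluster points *)

Section nonarchimedean_points.
Context {R : realType} {K : closedFieldType} (v : absvalue R K).
Hypothesis v_na : nonarchimedean v.
Variables (H : P1berk v -> P1berk v -> R) (H_can : is_can_kernel H).

(* [zeta] stands for the point of the Berkovich line attached to the chordal
   disk of radius [s] around [z]. *)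
Definition disk_point (z : P1 K) (s : R) (zeta : P1berk v) :=
  exists w : nat -> P1 K,
  [/\ forall k, chordal v z (w k) = s,
      forall k l, k != l -> chordal v (w k) (w l) = s &
      cluster ((fun k => typeI v (w k)) @ \oo) zeta].

Lemma disk_point_exists z b : v b <= 1 -> exists zeta, disk_point z (v b) zeta.
Proof.
move=> b1; have [w [w1 w2]] := equidistant_sequence v_na z b1.
have [zeta [_ cz]] := @one_point_compactification_compact (A1berk v)
  ((fun k => typeI v (w k)) @ \oo) _ filterT.
by exists zeta; exists w.
Qed.

(** The set where [h] is at most [a] is closed and contains a tail of the sequence. *)
Lemma cluster_le (x : nat -> P1berk v) zeta (h : P1berk v -> R) a :
  cluster (x @ \oo) zeta -> continuous h ->
  (exists k0, forall k, (k0 <= k)%N -> h (x k) <= a) -> h zeta <= a.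
Proof.
rewrite clusterE => cz ch [k0 hk0].
have : closure [set S | h S <= a] zeta by apply: cz; exists k0.
have cl : closed [set S | h S <= a].
  apply: (@closed_comp _ _ h [set r | r <= a]); last exact: closed_le.
  by move=> S _; exact: ch.
by rewrite -(closure_id _).1.
Qed.

Lemma cluster_eq (x : nat -> P1berk v) zeta (h : P1berk v -> R) a :
  cluster (x @ \oo) zeta -> continuous h ->
  (exists k0, forall k, (k0 <= k)%N -> h (x k) = a) -> h zeta = a.
Proof.
move=> cz ch [k0 hk0]; apply/eqP; rewrite eq_le; apply/andP; split.
  by apply: (cluster_le cz ch); exists k0 => k /hk0 ->.
rewrite -lerN2; apply: (cluster_le (h := fun S => - h S) cz).
  by move=> S; apply: continuousN; exact: ch.
by exists k0 => k /hk0 ->.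
Qed.

Lemma disk_point_kernel_typeI z s zeta y : disk_point z s zeta ->
  H zeta (typeI v y) = Num.max s (chordal v z y).
Proof.
have [HE _ _ cH] := H_can => -[w [w1 w2 cw]].
apply: (cluster_eq cw (cH (typeI v y))).
have [k0 wk0] := equidistant_chordal v_na w1 w2 y.
by exists k0 => k /wk0 <-; rewrite HE.
Qed.

(** With [zeta] fixed, the formula for classical points is evaluated along the sequence that
    clusters at [zeta']. Only one variable moves at a time, and the case [zeta = zeta'] is
    included. *)
Lemma disk_point_kernel z s zeta z' zeta' :
  disk_point z s zeta -> disk_point z' s zeta' ->
  H zeta zeta' = Num.max s (chordal v z z').
Proof.
have [HE _ cH _] := H_can => zz [w [w1 w2 cw]].
apply: (cluster_eq cw (cH zeta)).
have [k0 wk0] := equidistant_chordal v_na w1 w2 z.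
exists k0 => k /wk0; rewrite (disk_point_kernel_typeI _ zz) chordalC => ->.
by rewrite chordalC maxA maxxx.
Qed.

(** The kernel of [zeta] with infinity is at least [s], whereas infinity has kernel 0 with
    itself. *)
Lemma disk_point_Some z s zeta : 0 < s -> disk_point z s zeta ->
  exists x : A1berk v, zeta = Some x.
Proof.
move=> s0 zz; case: zeta zz => [x|] zz; first by exists x.
have := disk_point_kernel_typeI None zz; have [HE _ _ _] := H_can.
rewrite -[None in H None]/(typeI v None) HE chordalxx => /eqP.
by rewrite eq_sym gt_eqF// lt_max s0.
Qed.

End nonarchimedean_points.

(** * Jensen's formula *)

Section substitution.
Context {R : realType}.
Local Notation mu := (@lebesgue_measure R).
Implicit Types F G : R -> R.

Lemma Rintegral_affine G (al be a b : R) : 0 < al -> a <= b -> continuous G ->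
  \int[mu]_(x in `[al * a + be, al * b + be]) G x =
  al * \int[mu]_(x in `[a, b]) G (al * x + be).
Proof.
move=> al0 ab cG; pose F x : R := al * x + be.
have dF (x : R) : is_derive x 1 F al.
  by apply: is_derive_eq; rewrite addr0 ?scaler0 ?add0r [LHS]mulr1.
have F' : derive1 F = cst al by apply/funext => x; rewrite derive1E; apply: derive_val.
have cF : continuous F.
  by move=> x; apply: differentiable_continuous; apply/derivable1_diffP.
have cGF : continuous (fun x => G (F x)).
  by move=> x; apply: continuous_comp; [exact: cF|exact: cG].
rewrite -RintegralZl//; last first.
  apply: continuous_compact_integrable; first exact: segment_compact.
  exact: continuous_subspaceT.
rewrite /Rintegral; congr fine.
rewrite (@integration_by_substitution_increasing _ F G a b)//.
- by apply: eq_integral => x _; rewrite F' /= mulrC.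
- by move=> x y _ _ xy; rewrite /F ltrD2r ltr_pM2l.
- by rewrite F' => x _; exact: cvg_cst.
- by rewrite F'; exact: is_cvg_cst.
- by rewrite F'; exact: is_cvg_cst.
- split => [x _||]; first by [].
  + by apply: cvg_at_right_filter; exact: cF.
  + by apply: cvg_at_left_filter; exact: cF.
- exact: continuous_subspaceT.
Qed.

Lemma continuous_itv_integrable G (a b : R) : continuous G ->
  mu.-integrable `[a, b] (EFin \o G).
Proof.
move=> cG; apply: continuous_compact_integrable; first exact: segment_compact.
exact: continuous_subspaceT.
Qed.

(** Translating the right half of the interval onto the left half produces [F (2 * t)], and doubling
    stretches the half back to the full interval. *)
Lemma Rintegral_unit_itv_halves F G : continuous F -> continuous G ->
  (forall t, G t + G (t + 2^-1) = F (2 * t)) ->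
  \int[mu]_(t in `[0, 1]) G t = 2^-1 * \int[mu]_(t in `[0, 1]) F t.
Proof.
move=> cF cG GF.
have i01 : mu.-integrable `[0, 1] (EFin \o G) by exact: continuous_itv_integrable.
have half_ge0 : 0 <= 2^-1 :> R by rewrite invr_ge0.
have split01 : \int[mu]_(t in `[0, 1]) G t =
    \int[mu]_(t in `[0, 2^-1]) G t + \int[mu]_(t in `[2^-1, 1]) G t.
  rewrite -[X in _ + X]Rintegral_itv_obnd_cbnd; last first.
    by apply: integrableS (continuous_itv_integrable 2^-1 1 cG) => //;
      apply: subset_itvr; rewrite bnd_simp.
  rewrite -(@Rintegral_itvB _ G (BLeft 0) (BRight 1) 2^-1 i01) ?bnd_simp//; last first.
    by rewrite invf_le1// ler1n.
  by rewrite addrC subrK.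
have shift : \int[mu]_(t in `[2^-1, 1]) G t =
    \int[mu]_(t in `[0, 2^-1]) G (t + 2^-1).
  have := @Rintegral_affine G 1 2^-1 0 2^-1 ltr01 half_ge0 cG.
  rewrite (_ : 1 * 0 + 2^-1 = 2^-1 :> R); last by lra.
  rewrite (_ : 1 * 2^-1 + 2^-1 = 1 :> R); last by lra.
  by rewrite mul1r => ->; apply: eq_Rintegral => t _; rewrite mul1r.
have := @Rintegral_affine F 2 0 0 2^-1 (ltr0Sn _ _) half_ge0 cF.
rewrite (_ : 2 * 0 + 0 = 0 :> R); last by lra.
rewrite (_ : 2 * 2^-1 + 0 = 1 :> R); last by lra.
move=> ->; rewrite mulrA mulVf// mul1r split01 shift -RintegralD//.
- by apply: eq_Rintegral => t _; rewrite GF addr0.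
- exact: continuous_itv_integrable.
- apply: (@continuous_itv_integrable (fun t => G (t + 2^-1))) => t.
  by apply: continuous_comp; [apply: continuousD => //; exact: cvg_cst|exact: cG].
Qed.

End substitution.

Section circle.
Context {R : realType} {K : fieldType} (v : absvalue R K).
Variable sigma : {rmorphism R[i] -> K}.
Hypothesis sigma_iso : complex_iso v sigma.
Local Notation mu := (@lebesgue_measure R).
Local Notation P := (unit_prob R).

Definition circ (t : R) : K :=
  sigma (cos (2 * pi * t) +i* sin (2 * pi * t))%C.

Lemma absv_circ t : v (circ t) = 1.
Proof. by rewrite /circ sigma_iso.2 cos2Dsin2 sqrtr1. Qed.

Lemma circ_half t : circ (t + 2^-1) = - circ t.
Proof.
rewrite /circ (_ : 2 * pi * (t + 2^-1) = 2 * pi * t + pi); last by field.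
by rewrite cosDpi sinDpi -rmorphN.
Qed.

Lemma circ_double t : circ (2 * t) = circ t ^+ 2.
Proof.
rewrite /circ expr2 -rmorphM (_ : 2 * pi * (2 * t) = 2 * pi * t + 2 * pi * t); last by ring.
congr (sigma _); apply/eqP; rewrite eq_complex /= cosD sinD eqxx/=.
by apply/eqP; ring.
Qed.

Lemma absv_dist x y : `|v x - v y| <= v (x - y).
Proof.
rewrite ler_norml; apply/andP; split.
  rewrite lerNl opprB lerBlDr absvB -{1}(subrK x y); exact: absvD.
by rewrite lerBlDr -{1}(subrK y x); exact: absvD.
Qed.

Lemma continuous_absv_circ A B : continuous (fun t => v (A + B * circ t)).
Proof.
move=> u.
(* [D t] is the absolute value of the difference of the two points, written with real functions
   whose continuity is known; it bounds the difference of the absolute values. *)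
pose D t := v B * Num.sqrt ((cos (2 * pi * t) - cos (2 * pi * u)) ^+ 2 +
                            (sin (2 * pi * t) - sin (2 * pi * u)) ^+ 2).
have DE t : D t = v ((A + B * circ t) - (A + B * circ u)).
  rewrite (_ : _ - _ = B * (circ t - circ u)); last by ring.
  by rewrite absvM /circ -rmorphB sigma_iso.2.
have D0 t : 0 <= D t by rewrite DE absv_ge0.
have Du : D u = 0 by rewrite DE subrr absv0.
have cl : continuous (fun t : R => 2 * pi * t).
  exact: mulrl_continuous.
have csq (f : R -> R) : continuous f ->
    continuous (fun t => (f (2 * pi * t) - f (2 * pi * u)) ^+ 2).
  move=> cf t; apply: (@cvg_comp _ _ _ _ (fun x : R => x ^+ 2) _ _ _ _
    (@exprn_continuous R 2 _)).
  apply: cvgB; last exact: cvg_cst.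
  by apply: (@cvg_comp _ _ _ _ f _ _ _ (cl t)); exact: cf.
have cD : continuous D.
  move=> t; apply: cvgM; first exact: cvg_cst.
  apply: (@cvg_comp _ _ _ _ Num.sqrt _ _ _ _ (@sqrt_continuous R _)).
  by apply: cvgD; [exact: (csq _ (@continuous_cos R))|exact: (csq _ (@continuous_sin R))].
apply/cvgrPdist_lt => e e0.
have /cvgrPdist_lt /(_ _ e0) := cD u.
apply: filterS => t; apply: le_lt_trans.
by rewrite Du sub0r normrN (ger0_norm (D0 t)) DE distrC; exact: absv_dist.
Qed.

Lemma absv_circ_sub_le a t : v (circ t - a) <= 1 + v a.
Proof. by rewrite (le_trans (absvD _ _ _))// absvN absv_circ. Qed.

Lemma absv_circ_sub_ge a t : `|1 - v a| <= v (circ t - a).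
Proof. by rewrite -(absv_circ t); exact: absv_dist. Qed.

Lemma absv_circ_sub_gt0 a t : v a != 1 -> 0 < v (circ t - a).
Proof.
by move=> a1; rewrite (lt_le_trans _ (absv_circ_sub_ge a t))// normr_gt0 subr_eq0 eq_sym.
Qed.

Lemma continuous_absv_circ_sub a : continuous (fun t => v (circ t - a)).
Proof.
have := @continuous_absv_circ (- a) 1.
by under eq_fun do rewrite mul1r addrC.
Qed.

Let G a t := ln (v (circ t - a)).

Lemma continuous_ln_circ a : v a != 1 -> continuous (G a).
Proof.
move=> a1 t; apply: (@continuous_comp _ _ _ (fun t => v (circ t - a)) (@ln R)).
  exact: continuous_absv_circ_sub.
by apply: continuous_ln; exact: absv_circ_sub_gt0.
Qed.

(** For antipodal points of the circle the product of [x - a] and [- x - a] is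
    [- (x ^+ 2 - a ^+ 2)], and squaring doubles the angle. *)
Lemma mean_ln_circ_sqr a : v a != 1 ->
  \int[mu]_(t in `[0, 1]) G a t = 2^-1 * \int[mu]_(t in `[0, 1]) G (a ^+ 2) t.
Proof.
move=> a1; have a21 : v (a ^+ 2) != 1.
  by rewrite absvX sqrp_eq1// absv_ge0.
apply: Rintegral_unit_itv_halves; [exact: continuous_ln_circ..|].
move=> t; rewrite /G -lnM ?posrE ?absv_circ_sub_gt0//.
rewrite -absvM circ_half circ_double -absvN; congr (ln (v _)); ring.
Qed.

Lemma mean_ln_circ_lb a (m : R) : v a != 1 -> (forall t, m <= G a t) ->
  m <= \int[mu]_(t in `[0, 1]) G a t.
Proof.
move=> a1 mG.
have -> : m = \int[mu]_(t in `[0, 1]) m.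
  by rewrite Rintegral_cst//= lebesgue_measure_itv/= lte_fin ltr01 -EFinB/= subr0 mulr1.
apply: le_Rintegral => //; apply: continuous_itv_integrable.
- by move=> ?; exact: cvg_cst.
- exact: continuous_ln_circ.
Qed.

(* The defect [J a = int G a - ln (max 1 |a|)] satisfies [J a = J (a ^ 2) / 2]
   and is bounded below by [L a], with [L a <= L (a ^ 2)]. *)
Lemma jensen_off_circle a : v a != 1 ->
  ln (Num.max 1 (v a)) <= \int[mu]_(t in `[0, 1]) G a t.
Proof.
pose J a := \int[mu]_(t in `[0, 1]) G a t - ln (Num.max 1 (v a)).
pose L a := ln `|1 - v a| - ln (Num.max 1 (v a)).
have max_gt0 a' : 0 < Num.max 1 (v a') by rewrite lt_max ltr01.
have ln_max_sqr a' : ln (Num.max 1 (v (a' ^+ 2))) = 2 * ln (Num.max 1 (v a')).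
  rewrite mulr_natl -lnXn//; congr ln; rewrite absvX.
  have [a1|a1] := leP (v a') 1.
    by rewrite expr1n (max_idPl _)// expr_le1 ?absv_ge0.
  by rewrite (max_idPr _)// expr_ge1 ?absv_ge0 ?ltW.
have Lsqr a' : v a' != 1 -> L a' <= L (a' ^+ 2).
  move=> a1; rewrite /L ln_max_sqr absvX.
  have -> : 1 - v a' ^+ 2 = (1 - v a') * (1 + v a') by ring.
  have va : 0 < 1 + v a' by rewrite ltr_pwDl// absv_ge0.
  have n1 : `|1 - v a'| \is Num.pos by rewrite posrE normr_gt0 subr_eq0 eq_sym.
  have n2 : `|1 + v a'| \is Num.pos by rewrite posrE normr_gt0 gt_eqF.
  rewrite normrM lnM//.
  rewrite (ger0_norm (ltW va)).
  (* Since [1 - v a' ^+ 2] factors, the increase of [L] reduces to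
     [Num.max 1 (v a') <= 1 + v a']. *)
  suff : ln (Num.max 1 (v a')) <= ln (1 + v a') by lra.
  by rewrite ler_ln ?posrE// ge_max lerDl lerDr absv_ge0 ler01.
(* Each squaring halves the defect and does not lower the bound [L]. Letting [k] tend to infinity
   then gives a nonnegative defect. *)
have JL k a' : v a' != 1 -> 2^-1 ^+ k * L a' <= J a'.
  elim: k a' => [|k IH] a' a1.
    rewrite expr0 mul1r /L /J lerD2r; apply: mean_ln_circ_lb => // t.
    rewrite /G ler_ln ?posrE ?absv_circ_sub_gt0 ?absv_circ_sub_ge//.
    by rewrite normr_gt0 subr_eq0 eq_sym.
  have a21 : v (a' ^+ 2) != 1 by rewrite absvX sqrp_eq1// absv_ge0.
  have -> : J a' = 2^-1 * J (a' ^+ 2).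
    by rewrite /J mean_ln_circ_sqr// ln_max_sqr; field.
  rewrite exprS -mulrA ler_pM2l ?invr_gt0// (le_trans _ (IH _ a21))//.
  by rewrite ler_pM2l ?exprn_gt0 ?invr_gt0// Lsqr.
move=> a1; rewrite -subr_ge0 -/(J a).
have cv : (fun k => 2^-1 ^+ k * L a) @ \oo --> 0 * L a.
  apply: cvgM; last exact: cvg_cst.
  by apply: cvg_expr; rewrite ger0_norm ?invr_ge0// invf_lt1// ltr1n.
rewrite -(mul0r (L a)) -(cvg_lim _ cv)//.
by apply: limr_le; [apply/cvg_ex; exists (0 * L a)|near=> k; exact: JL].
Unshelve. all: by end_near. Qed.

End circle.

Section jensen.
Context {R : realType} {K : fieldType} (v : absvalue R K).
Variable sigma : {rmorphism R[i] -> K}.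
Hypothesis sigma_iso : complex_iso v sigma.
Local Notation mu := (@lebesgue_measure R).
Local Notation P := (unit_prob R).
Local Notation circ := (circ sigma).

(** The limit [x] may be 0, where the expression is +oo; this happens at parameters with
    [circ t = a]. *)
Lemma cvg_sub_lne (u : nat -> R) (x c : R) : (forall k, 0 < u k) -> 0 <= x ->
  u @ \oo --> x ->
  (fun k => c%:E - lne (u k)%:E)%E @ \oo --> (c%:E - lne x%:E)%E.
Proof.
move=> u0; rewrite le_eqVlt => /predU1P[<-|x0] ux; last first.
  rewrite lne_EFin// -EFinB.
  under eq_fun do rewrite lne_EFin// -EFinB.
  apply: (@cvg_comp _ _ _ (fun k => c - ln (u k)) EFin _ (nbhs (c - ln x))) => //.
  apply: cvgB; first exact: cvg_cst.
  by apply: (@cvg_comp _ _ _ u (@ln R) _ (nbhs x)) => //; exact: continuous_ln.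
rewrite le0_lneNy// -[(_ - -oo)%E]/(+oo%E); apply/cvgeyPge => A.
have : \forall k \near \oo, u k < expR (c - A).
  by apply: (cvgr_lt _ ux); exact: expR_gt0.
apply: filterS => k uk; rewrite lne_EFin// -EFinB lee_fin.
by rewrite lerBrDl -lerBrDr -ler_expR lnK ?posrE ?ltW.
Qed.

Lemma measurable_circ_sub a :
  measurable_fun setT (fun t : measurableTypeR R => v (circ t - a)).
Proof.
exact: continuous_measurable_fun (@continuous_absv_circ_sub _ _ _ _ sigma_iso a).
Qed.

Lemma measurable_sub_lne_circ a c : measurable_fun setT
  (fun t : measurableTypeR R => (c%:E - lne (v (circ t - a))%:E)%E).
Proof.
apply: emeasurable_funB => //.
exact: measurableT_comp measurable_lne_EFin (measurable_circ_sub a).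
Qed.

(** Subtracting the logarithm from a large constant makes it nonnegative, as Fatou's lemma
    requires. *)
Lemma sub_lne_circ_ge0 a c t : ln (1 + v a) <= c ->
  (0 <= c%:E - lne (v (circ t - a))%:E)%E.
Proof.
move=> ac; have [->|x0] := eqVneq (v (circ t - a)) 0.
  by rewrite le0_lneNy// -[(_ - -oo)%E]/(+oo%E) leey.
have {}x0 : 0 < v (circ t - a) by rewrite lt0r x0 absv_ge0.
rewrite lne_EFin// -EFinB lee_fin subr_ge0 (le_trans _ ac)//.
rewrite ler_ln ?posrE ?absv_circ_sub_le//.
by rewrite (lt_le_trans x0)// absv_circ_sub_le.
Qed.

Lemma jensen_defect_off_circle a c : v a != 1 -> ln (1 + v a) <= c ->
  (\int[P]_t (c%:E - lne (v (circ t - a))%:E) <=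
   (c - ln (Num.max 1 (v a)))%:E)%E.
Proof.
move=> a1 ac.
rewrite integral_unit_prob; last 2 first.
- exact: measurable_sub_lne_circ.
- by move=> t; exact: sub_lne_circ_ge0.
under eq_integral.
  move=> t _; rewrite lne_EFin ?(absv_circ_sub_gt0 sigma_iso)// -EFinB; over.
have cG := @continuous_ln_circ _ _ _ _ sigma_iso a a1.
have cc : continuous (fun _ : R => c) by move=> ?; exact: cvg_cst.
have iG : mu.-integrable `[0, 1] (EFin \o (fun t => c - ln (v (circ t - a)))).
  apply: continuous_itv_integrable => t.
  by apply: cvgB; [exact: cvg_cst|exact: cG].
rewrite -(fineK (integrable_fin_num _ iG))// lee_fin -[leLHS]/(Rintegral _ _ _).
rewrite RintegralB//; [|exact: continuous_itv_integrable..].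
rewrite Rintegral_cst//= lebesgue_measure_itv/= lte_fin ltr01 -EFinB/= subr0 mulr1.
by rewrite lerB// jensen_off_circle.
Qed.

(* On the unit circle itself the formula is the limit, by Fatou's lemma, of the
   formula at points of smaller absolute value. *)
Lemma jensen_defect a c : ln (1 + v a) <= c ->
  (\int[P]_t (c%:E - lne (v (circ t - a))%:E) <=
   (c - ln (Num.max 1 (v a)))%:E)%E.
Proof.
have [a1 ac|a1] := eqVneq (v a) 1; last exact: jensen_defect_off_circle.
pose r k : R := 1 - k.+2%:R^-1.
have r0 k : 0 <= r k by rewrite subr_ge0 invf_le1// ler1n.
have r1 k : r k < 1 by rewrite ltrBlDl ltrDr invr_gt0.
pose s k := sigma (r k +i* 0)%C.
have vs k : v (s k) = r k.
  by rewrite sigma_iso.2 expr0n addr0 sqrtr_sqr ger0_norm.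
pose f k (t : measurableTypeR R) : \bar R := (c%:E - lne (v (circ t - s k * a))%:E)%E.
have vsa k : v (s k * a) = r k by rewrite absvM vs a1 mulr1.
have sac k : ln (1 + v (s k * a)) <= c.
  rewrite (le_trans _ ac)// vsa a1 ler_ln ?posrE ?ltr_pwDl// ?lerD2l ?(ltW (r1 k))//.
(* The integrand is the pointwise limit of the [f k], hence their lower limit. *)
have -> : (\int[P]_t (c%:E - lne (v (circ t - a))%:E) =
    \int[P]_t limn_einf (f^~ t))%E.
  apply: eq_integral => t _.
  have : (f^~ t) @ \oo --> (c%:E - lne (v (circ t - a))%:E)%E.
    apply: cvg_sub_lne; last 2 first.
    - exact: absv_ge0.
    - apply/cvgrPdist_lt => e e0; near=> k.
      rewrite (le_lt_trans (absv_dist _ _ _))//.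
      have -> : circ t - a - (circ t - s k * a) = (s k - 1) * a by ring.
      rewrite absvM a1 mulr1 -(rmorph1 sigma) -rmorphB sigma_iso.2 /=.
      rewrite subrr expr0n addr0 sqrtr_sqr distrC ger0_norm ?subr_ge0 ?(ltW (r1 k))//.
      rewrite /r opprB addrC subrK; near: k.
      have := near_infty_natSinv_lt (PosNum e0).
      by move=> [N _ NP]; exists N => // k Nk; apply: NP => /=; exact: leq_trans Nk _.
    - by move=> k; rewrite (absv_circ_sub_gt0 sigma_iso)// vsa lt_eqF.
  by move=> /cvg_limn_einf_sup[->].
apply: le_trans (fatou P measurableT _ _) _.
- by move=> k; exact: measurable_sub_lne_circ.
- by move=> k t _; exact: sub_lne_circ_ge0.
rewrite a1 maxxx ln1 subr0.
apply: le_trans (limn_einf_sup _) _; rewrite limn_esup_lim.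
apply: lime_le; first exact: is_cvg_esups.
(* The points [s k * a] lie inside the unit circle, so the logarithmic term vanishes and each
   approximating integral is at most [c]. *)
apply: nearW => m; apply: ge_ereal_sup => _ [k _ <-].
have /= := jensen_defect_off_circle (_ : v (s k * a) != 1) (sac k).
rewrite vsa lt_eqF// (max_idPl (ltW (r1 k))) ln1 subr0; exact.
Unshelve. all: by end_near. Qed.

Lemma jensen_unit a :
  ((ln (Num.max 1 (v a)))%:E <= \int[P]_t lne (v (circ t - a))%:E)%E.
Proof.
pose c := ln (1 + v a); pose f (t : measurableTypeR R) : \bar R := (c%:E - lne (v (circ t - a))%:E)%E.
have f0 t : (0 <= f t)%E by exact: sub_lne_circ_ge0.
have mf := measurable_sub_lne_circ a c.
have fE t : (lne (v (circ t - a))%:E = - f t + c%:E)%E.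
  by rewrite /f; case: (lne _) => [y||]//; rewrite -EFinB -EFinN -EFinD; congr EFin; ring.
under eq_integral do rewrite fE.
apply: le_trans (@le_integral_shift _ _ _ P 0 c (fun t => - f t)%E _ _); last 2 first.
- exact: measurableT_comp.
- by move=> t; rewrite oppe_le0.
rewrite integral_ge0N// -leeBlDr// -EFinB leeNr -EFinN opprB.
exact: jensen_defect.
Qed.

(** Factoring out [B] reduces to the unit case with [a = - (A / B)]. For [B = 0] the integrand is
    constant. *)
Lemma jensen A B : (lne (Num.max (v A) (v B))%:E <=
  \int[P]_t lne (v (A + B * circ t))%:E)%E.
Proof.
have [->|B0] := eqVneq B 0.
  rewrite absv0 (max_idPl (absv_ge0 _ _)).
  under eq_integral do rewrite mul0r addr0.
  have [->|A0] := eqVneq A 0; first by rewrite absv0 le0_lneNy// leNye.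
  by rewrite lne_EFin ?absv_gt0// integral_cst//= probability_setT mule1.
have vB : 0 < v B by rewrite absv_gt0.
pose a := - (A / B).
have abE t : (lne (v (A + B * circ t))%:E =
    lne (v (circ t - a))%:E + (ln (v B))%:E)%E.
  have -> : A + B * circ t = (circ t - a) * B by rewrite /a; field.
  rewrite absvM; have [->|x0] := eqVneq (v (circ t - a)) 0.
    by rewrite mul0r le0_lneNy.
  have {}x0 : 0 < v (circ t - a) by rewrite lt0r x0 absv_ge0.
  by rewrite !lne_EFin ?mulr_gt0// lnM// EFinD.
under eq_integral do rewrite abE.
apply: le_trans (@le_integral_shift _ _ _ P (ln (1 + v a)) (ln (v B)) _ _ _); last 2 first.
- exact: measurableT_comp measurable_lne_EFin (measurable_circ_sub a).
- by move=> t; rewrite -sube_ge0 ?orbT//; exact: sub_lne_circ_ge0.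
apply: le_trans (leeD2r _ (jensen_unit a)).
rewrite -EFinD -lnM ?posrE// ?lt_max ?ltr01// lne_EFin ?lt_max ?vB ?orbT//.
by rewrite lee_fin maxr_pMl ?(ltW vB)// mul1r -absvM /a mulNr mulfVK// absvN maxC.
Qed.

End jensen.

(** * Archimedean circles *)

Section absv_continuity.
Context {R : realType} {K : fieldType} (v : absvalue R K).

(** The field [K] carries no topology here, so continuity of a curve in it is expressed through
    [v]. *)
Definition absv_continuous (x : R -> K) :=
  forall u, (fun t => v (x t - x u)) @ u --> (0 : R).

Lemma absv_continuous_squeeze (x : R -> K) u (h : R -> R) :
  (forall t, v (x t - x u) <= h t) -> h @ u --> (0 : R) ->
  (fun t => v (x t - x u)) @ u --> (0 : R).
Proof.
move=> xh h0; apply: (squeeze_cvgr _ (cvg_cst 0) h0).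
by apply: nearW => t; rewrite absv_ge0 xh.
Qed.

Lemma absv_continuousP (x : R -> K) :
  absv_continuous x -> continuous (fun t => v (x t)).
Proof.
move=> cx u; apply/cvgrPdist_lt => e e0.
have /cvgrPdist_lt /(_ _ e0) := cx u; apply: filterS => t.
rewrite sub0r normrN ger0_norm ?absv_ge0//; apply: le_lt_trans.
by rewrite distrC; exact: absv_dist.
Qed.

Lemma absv_continuous_cst a : absv_continuous (fun=> a).
Proof. by move=> u; rewrite subrr absv0; exact: cvg_cst. Qed.

Lemma absv_continuousD x y : absv_continuous x -> absv_continuous y ->
  absv_continuous (fun t => x t + y t).
Proof.
move=> cx cy u.
apply: (@absv_continuous_squeeze (fun t => x t + y t) u
  (fun t => v (x t - x u) + v (y t - y u))) => [t|].
  rewrite (_ : _ - _ = (x t - x u) + (y t - y u)); first exact: absvD.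
  by ring.
by rewrite -[X in _ --> X]addr0; apply: cvgD; [exact: cx|exact: cy].
Qed.

Lemma absv_continuousM x y : absv_continuous x -> absv_continuous y ->
  absv_continuous (fun t => x t * y t).
Proof.
move=> cx cy u.
apply: (@absv_continuous_squeeze (fun t => x t * y t) u
  (fun t => v (x t) * v (y t - y u) + v (x t - x u) * v (y u))) => [t|].
  rewrite (_ : _ - _ = x t * (y t - y u) + (x t - x u) * y u); last by ring.
  by rewrite -!absvM; exact: absvD.
rewrite [X in _ --> X](_ : _ = v (x u) * 0 + 0 * v (y u)); last by ring.
apply: cvgD; apply: cvgM; [exact: absv_continuousP|exact: cy|exact: cx|exact: cvg_cst].
Qed.

Lemma absv_continuousV x : absv_continuous x -> (forall t, x t != 0) ->
  absv_continuous (fun t => (x t)^-1).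
Proof.
move=> cx x0 u.
have -> : (fun t => v ((x t)^-1 - (x u)^-1)) =
    (fun t => v (x t - x u) * ((v (x t))^-1 * (v (x u))^-1)).
  apply/funext => t; rewrite -!absvV -!absvM absvB; congr (v _).
  by field; rewrite !x0.
rewrite [X in _ --> X](_ : _ = 0 * ((v (x u))^-1 * (v (x u))^-1)); last by ring.
apply: cvgM; first exact: cx.
apply: cvgM; last exact: cvg_cst.
by apply: cvgV; [rewrite absv_eq0|exact: absv_continuousP].
Qed.

(** With the topology of pointwise convergence on seminorms, this yields the continuity of the
    circles as curves in the Berkovich affine line. *)
Lemma absv_continuous_horner (f : {poly K}) x : absv_continuous x ->
  absv_continuous (fun t => f.[x t]).
Proof.
move=> cx; elim/poly_ind: f => [|f c IH].
  by under eq_fun do rewrite horner0; exact: absv_continuous_cst.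
under eq_fun do rewrite hornerMXaddC.
apply: absv_continuousD; last exact: absv_continuous_cst.
exact: absv_continuousM.
Qed.

End absv_continuity.

Section chordal_circles.
Context {R : realType} {K : fieldType} (v : absvalue R K).
Variable sigma : {rmorphism R[i] -> K}.
Hypothesis sigma_iso : complex_iso v sigma.
Hypothesis v_arch : ~ nonarchimedean v.
Local Notation P := (unit_prob R).
Local Notation circ := (circ sigma).

Definition real_scalar (r : R) : K := sigma (r +i* 0)%C.

Lemma absv_real_scalar r : 0 <= r -> v (real_scalar r) = r.
Proof. by move=> r0; rewrite sigma_iso.2 expr0n addr0 sqrtr_sqr ger0_norm. Qed.

Lemma norm2_sqr p : norm2 v p ^+ 2 = v p.1 ^+ 2 + v p.2 ^+ 2.
Proof. by rewrite /norm2 asboolF// sqr_sqrtr// addr_ge0 ?sqr_ge0. Qed.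

Lemma sqr_absv_sigma a b : v (sigma (a +i* b)%C) ^+ 2 = a ^+ 2 + b ^+ 2.
Proof. by rewrite sigma_iso.2 sqr_sqrtr// addr_ge0 ?sqr_ge0. Qed.

Lemma sigma_surj x : exists a b, x = sigma (a +i* b)%C.
Proof.
by have [[tau _ sK] _] := sigma_iso; case E : (tau x) => [a b]; exists a, b; rewrite -E sK.
Qed.

(* With bars for complex conjugation, [q = (- bar p.2, bar p.1)]. *)
Definition orthogonal_to (p q : K * K) := exists a b a' b',
  p = (sigma (a +i* b)%C, sigma (a' +i* b')%C) /\
  q = (sigma (- a' +i* b')%C, sigma (a +i* - b)%C).

Lemma orthogonal_exists p : exists q, orthogonal_to p q.
Proof.
case: p => p0 p1; have [a [b ->]] := sigma_surj p0.
have [a' [b' ->]] := sigma_surj p1.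
by eexists; exists a, b, a', b'.
Qed.

(** Pythagoras: up to sign, [det2 p x] and [det2 q x] are the Hermitian products of [x] with [q] and
    with [p], which are orthogonal of equal norm. *)
Lemma det2_orthogonal p q x : orthogonal_to p q ->
  v (det2 p x) ^+ 2 + v (det2 q x) ^+ 2 = norm2 v p ^+ 2 * norm2 v x ^+ 2.
Proof.
move=> [a [b [a' [b' [-> ->]]]]]; rewrite !norm2_sqr /det2 /=.
case: x => x0 x1 /=; have [d [e ->]] := sigma_surj x0.
have [d' [e' ->]] := sigma_surj x1.
rewrite -!rmorphM -!rmorphB /= !sqr_absv_sigma; ring.
Qed.

(** Pythagoras again: the coefficients on [p] and [q] have absolute values [|c|] and [|s|]. *)
Lemma norm2_circle p q c s t : orthogonal_to p q -> c ^+ 2 + s ^+ 2 = 1 ->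
  norm2 v (real_scalar c * p.1 + real_scalar s * circ t * q.1,
           real_scalar c * p.2 + real_scalar s * circ t * q.2) = norm2 v p.
Proof.
move=> [a [b [a' [b' [-> ->]]]]] cs; apply/eqP.
rewrite -(@eqrXn2 _ 2)// ?norm2_ge0// !norm2_sqr /= /real_scalar /circ.
have := cos2Dsin2 (2 * pi * t); set x := cos _; set y := sin _ => xy.
rewrite -!rmorphM -!rmorphD /= !sqr_absv_sigma; apply/eqP.
transitivity ((c ^+ 2 + s ^+ 2 * (x ^+ 2 + y ^+ 2)) *
  (a ^+ 2 + b ^+ 2 + (a' ^+ 2 + b' ^+ 2))); first by ring.
by rewrite xy mulr1 cs mul1r.
Qed.

Lemma chordal_le1_arch z w : chordal v z w <= 1.
Proof.
rewrite /chordal -/(det2 _ _); have p0 := norm2_lift_gt0 v z.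
have q0 := norm2_lift_gt0 v w.
rewrite ler_pdivrMr ?mulr_gt0// mul1r.
rewrite -(@ler_pXn2r _ 2)// ?nnegrE ?absv_ge0 ?mulr_ge0 ?(ltW p0) ?(ltW q0)//.
have [q pq] := orthogonal_exists (Defs.lift z).
by rewrite exprMn -(det2_orthogonal (Defs.lift w) pq) lerDl sqr_ge0.
Qed.

Variables (c s : R).
Hypotheses (c_gt0 : 0 < c) (s_gt0 : 0 < s) (cs1 : c ^+ 2 + s ^+ 2 = 1).

Definition perp (z : P1 K) : K * K := xget (0, 0) (orthogonal_to (Defs.lift z)).

Lemma perpP z : orthogonal_to (Defs.lift z) (perp z).
Proof. by rewrite /perp; case: xgetP => // /(_ _) h; have [q /h] := orthogonal_exists (Defs.lift z). Qed.

Definition circle_lift z t : K * K :=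
  let p := Defs.lift z in let q := perp z in
  (real_scalar c * p.1 + real_scalar s * circ t * q.1,
   real_scalar c * p.2 + real_scalar s * circ t * q.2).

Definition circle_coord z t : K := (circle_lift z t).2 / (circle_lift z t).1.

(** If the first coordinate vanished, the circle would pass through infinity. Writing [x], [y] for
    the absolute values of the coordinates of the lift of [z], this gives [c * x = s * y], whence
    [s] is the distance [x / N] from [z] to infinity. *)
Lemma circle_lift_neq0 z t : s != chordal v z None -> (circle_lift z t).1 != 0.
Proof.
move=> sz; apply/negP => /eqP P0.
have N0 := norm2_lift_gt0 v z.
have vp : c * v (Defs.lift z).1 = s * v (perp z).1.
  have : v (real_scalar c * (Defs.lift z).1) = v (real_scalar s * circ t * (perp z).1).
    by rewrite -[RHS]absvN; congr (v _); apply/eqP; rewrite -addr_eq0 -P0.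
  by rewrite !absvM !absv_real_scalar ?ltW// (absv_circ sigma_iso) mulr1.
have vperp : v (perp z).1 = v (Defs.lift z).2.
  have [a [b [a' [b' [-> ->]]]]] := perpP z; rewrite /= !sigma_iso.2.
  by rewrite sqrrN.
have := norm2_sqr (Defs.lift z); rewrite vperp in vp.
move: sz; rewrite /chordal /= mulr0 subr0 mulr1.
have -> : norm2 v (0, 1) = 1.
  by rewrite /norm2 asboolF//= absv0 absv1 expr0n expr1n add0r sqrtr1.
rewrite mulr1; set x := v _ in vp *; set N := norm2 _ _ in N0 *.
set y := v _ in vp * => sN NE.
have x0 : 0 <= x by exact: absv_ge0.
move/negP: sN; apply.
rewrite -(@eqrXn2 _ 2)// ?divr_ge0 ?(ltW N0) ?(ltW s_gt0)// expr_div_n NE.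
have xy0 : x ^+ 2 + y ^+ 2 != 0 by rewrite -NE expf_neq0// gt_eqF.
rewrite -(inj_eq (mulIf xy0)) divfK//; apply/eqP.
have : (c * x) ^+ 2 = (s * y) ^+ 2 by rewrite vp.
by rewrite !exprMn mulrDr => <-; rewrite -mulrDl addrC cs1 mul1r.
Qed.

Lemma circle_coordP z t : s != chordal v z None ->
  exists2 a, a != 0 & Defs.lift (Some (circle_coord z t)) =
    (a * (circle_lift z t).1, a * (circle_lift z t).2).
Proof.
move=> sz; exists (circle_lift z t).1^-1; rewrite ?invr_eq0 ?circle_lift_neq0//=.
by rewrite mulVf ?circle_lift_neq0// /circle_coord mulrC.
Qed.

Lemma chordal_circle z w t : s != chordal v z None ->
  chordal v (Some (circle_coord z t)) w =
  v (real_scalar c * det2 (Defs.lift z) (Defs.lift w) +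
     real_scalar s * det2 (perp z) (Defs.lift w) * circ t) /
  (norm2 v (Defs.lift z) * norm2 v (Defs.lift w)).
Proof.
move=> sz; have [a a0 aE] := circle_coordP t sz.
have bE : Defs.lift w = (1 * (Defs.lift w).1, 1 * (Defs.lift w).2).
  by rewrite !mul1r -surjective_pairing.
rewrite (chordal_homogeneous v a0 (oner_neq0 _) aE bE).
rewrite /circle_lift (norm2_circle t (perpP z) cs1); congr (v _ / _).
by rewrite /det2 /=; ring.
Qed.

(** The chordal distance and this quotient are the two normalized components in [det2_orthogonal],
    so their squares add up to 1. *)
Lemma det2_perp z w : v (det2 (perp z) (Defs.lift w)) /
    (norm2 v (Defs.lift z) * norm2 v (Defs.lift w)) =
  Num.sqrt (1 - chordal v z w ^+ 2).
Proof.
have p0 := norm2_lift_gt0 v z; have q0 := norm2_lift_gt0 v w.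
have D0 : 0 < norm2 v (Defs.lift z) * norm2 v (Defs.lift w) by rewrite mulr_gt0.
set x := LHS; have x0 : 0 <= x by rewrite divr_ge0 ?absv_ge0 ?(ltW D0).
rewrite -(ger0_norm x0) -sqrtr_sqr; congr Num.sqrt.
rewrite /x /chordal -/(det2 _ _) !expr_div_n exprMn.
rewrite -(det2_orthogonal (Defs.lift w) (perpP z)).
have := det2_orthogonal (Defs.lift w) (perpP z); rewrite -exprMn.
set d := _ + _ => dE; have d0 : d != 0 by rewrite dE expf_neq0// gt_eqF.
by rewrite -[X in X - _](divff d0) -mulrBl; congr (_ / _); rewrite /d addrAC subrr add0r.
Qed.

Lemma chordal_circle_center z t : s != chordal v z None ->
  chordal v z (Some (circle_coord z t)) = s.
Proof.
move=> sz; rewrite chordalC chordal_circle//.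
have -> : det2 (Defs.lift z) (Defs.lift z) = 0 by rewrite /det2; ring.
rewrite mulr0 add0r !absvM (absv_circ sigma_iso) mulr1.
rewrite absv_real_scalar ?(ltW s_gt0)// -mulrA det2_perp chordalxx.
by rewrite expr0n subr0 sqrtr1 mulr1.
Qed.

Lemma mean_lne_chordal_circle z w : s != chordal v z None ->
  (lne (Num.max (c * chordal v z w) (s * Num.sqrt (1 - chordal v z w ^+ 2)))%:E <=
   \int[P]_t lne (chordal v (Some (circle_coord z t)) w)%:E)%E.
Proof.
move=> sz; have p0 := norm2_lift_gt0 v z; have q0 := norm2_lift_gt0 v w.
pose D := (norm2 v (Defs.lift z) * norm2 v (Defs.lift w))^-1.
have D0 : 0 <= D by rewrite invr_ge0 mulr_ge0 ?(ltW p0) ?(ltW q0).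
(* The norms of the lifts do not depend on [t]; the factor [D] absorbs them into the two
   coefficients of Jensen's formula. *)
have := jensen sigma_iso
  (real_scalar D * (real_scalar c * det2 (Defs.lift z) (Defs.lift w)))
  (real_scalar D * (real_scalar s * det2 (perp z) (Defs.lift w))).
rewrite !absvM !absv_real_scalar ?(ltW c_gt0) ?(ltW s_gt0)//.
rewrite (mulrCA D c) (mulrCA D s) ![D * _]mulrC det2_perp -[_ * D]/(chordal v z w).
move=> /le_trans; apply; rewrite le_eqVlt; apply/orP; left; apply/eqP.
apply: eq_integral => t _; rewrite chordal_circle//; congr (lne _%:E).
by rewrite -/D -[X in _ = _ * X](absv_real_scalar D0) -absvM; congr (v _); ring.
Qed.

Lemma circle_coord_continuous z : s != chordal v z None ->
  absv_continuous v (circle_coord z).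
Proof.
move=> sz.
have ccirc : absv_continuous v circ.
  move=> u; have := @continuous_absv_circ_sub _ _ _ _ sigma_iso (circ u) u.
  by rewrite /continuous_at subrr absv0.
apply: absv_continuousM.
  apply: absv_continuousD; first exact: absv_continuous_cst.
  apply: absv_continuousM; last exact: absv_continuous_cst.
  by apply: absv_continuousM; first exact: absv_continuous_cst.
apply: absv_continuousV; last by move=> t; exact: circle_lift_neq0.
apply: absv_continuousD; first exact: absv_continuous_cst.
apply: absv_continuousM; last exact: absv_continuous_cst.
by apply: absv_continuousM; first exact: absv_continuous_cst.
Qed.

End chordal_circles.

(** * Optimization of the radius *)

Section radius_optimization.
Context {R : realType}.

Lemma sum_diagonal (n : nat) (a b : R) :
  \sum_(i < n) \sum_(j < n) (b + (if i == j then a else 0)) =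
  n%:R ^+ 2 * b + n%:R * a.
Proof.
rewrite (eq_bigr (fun=> n%:R * b + a)) => [|i _].
  by rewrite sumr_const card_ord -(mulr_natl (_ + _)); ring.
rewrite big_split /= sumr_const card_ord -(mulr_natl b); congr (_ + _).
by rewrite -big_mkcond/= (big_pred1 i)// => j; rewrite eq_sym.
Qed.

Lemma sum_le_optimal_radius (n : nat) (kappa C epsK G : R) (h : 'I_n -> R)
    (d : 'I_n -> 'I_n -> R) :
  (0 < n)%N -> 1 <= kappa -> 0 <= C -> 0 <= epsK -> (forall i, `|h i| <= G) ->
  (forall delta, 0 < delta -> exists s c,
    [/\ expR (- delta) * n%:R `^ (- kappa) <= s <= n%:R `^ (- kappa), 0 < c,
        - ln c <= epsK * n%:R `^ (- kappa) &
        \sum_(i < n) \sum_(j < n)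
          ((if i == j then ln (c * s) else 2 * ln c + d i j)
           - h i - h j - 2 * (C * s `^ kappa^-1)) <= 0]) ->
  \sum_(i < n) \sum_(j < n) (if i == j then 0 else d i j - h i - h j) <=
  kappa * n%:R * ln n%:R + 2 * n%:R * (C + epsK * n%:R `^ (1 - kappa) + G).
Proof.
move=> n0 k1 C0 eps0 hG reg; set N : R := n%:R; rewrite -/N in reg.
have N0 : 0 < N by rewrite ltr0n.
have kp0 : 0 < kappa by rewrite (lt_le_trans ltr01).
apply/ler_addgt0Pr => e e0.
(* Only the diagonal terms contain [ln s]; there are [N] of them, so [delta = e / N] causes a total
   error of [e]. *)
have [|s [c [/andP[sl su] c0 lc tot]]] := reg (e / N); first by rewrite divr_gt0.
set ep := N `^ (- kappa) in sl su lc.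
have ep0 : 0 < ep by rewrite powR_gt0.
have s0 : 0 < s by rewrite (lt_le_trans _ sl)// mulr_gt0// expR_gt0.
have lns : - ln s <= kappa * ln N + e / N.
  have : ln (expR (- (e / N)) * ep) <= ln s.
    by rewrite ler_ln ?posrE// mulr_gt0// expR_gt0.
  rewrite lnM ?posrE ?expR_gt0// expRK /ep ln_powR; lra.
have sN : s `^ kappa^-1 <= N^-1.
  have -> : N^-1 = ep `^ kappa^-1.
    by rewrite /ep -powRrM mulNr divff ?gt_eqF// powRN powRr1// ltW.
  by apply: ge0_ler_powR; rewrite ?nnegrE ?invr_ge0 ?(ltW s0) ?(ltW ep0) ?(ltW kp0).
have CN : C * s `^ kappa^-1 <= C / N by rewrite ler_wpM2l.
have Nep : N * ep = N `^ (1 - kappa).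
  rewrite powRD; last by rewrite (gt_eqF N0) implybT.
  by rewrite powRr1// ltW.
(* [b] pays, for every pair, for the two factors [c] and for the variation of [g]; [a] pays, on the
   diagonal only, for [ln s] and for the two values of [g]. *)
pose b := 2 * (epsK * ep) + 2 * (C / N).
pose a := kappa * ln N + e / N + 2 * G.
apply: (@le_trans _ _ (\sum_(i < n) \sum_(j < n)
  (((if i == j then ln (c * s) else 2 * ln c + d i j)
           - h i - h j - 2 * (C * s `^ kappa^-1)) + (b + (if i == j then a else 0))))).
  apply: ler_sum => i _; apply: ler_sum => j _; rewrite /a /b.
  have epe : 0 <= epsK * ep by rewrite mulr_ge0 ?(ltW ep0).
  case: eqVneq => [<-|_]; last by lra.
  rewrite lnM ?posrE//.
  by have := hG i; rewrite ler_norml => /andP[_ hi]; lra.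
under eq_bigr do rewrite big_split/=.
rewrite big_split/= sum_diagonal -/N /a /b -Nep.
apply: (@le_trans _ _ (N ^+ 2 * (2 * (epsK * ep) + 2 * (C / N)) +
  N * (kappa * ln N + e / N + 2 * G))); first by lra.
have E1 : N ^+ 2 * (C / N) = N * C by field; rewrite gt_eqF.
have E2 : N * (e / N) = e by field; rewrite gt_eqF.
rewrite !mulrDr mulrCA (mulrCA _ 2 (C / N)) E1 E2 le_eqVlt; apply/orP; left; apply/eqP.
by ring.
Qed.

Lemma le_lne_EFin (x y : R) : 0 <= x -> x <= y -> (lne x%:E <= lne y%:E)%E.
Proof.
move=> x0 xy; rewrite lee_lne ?lee_fin// in_itv/= leey andbT lee_fin//.
exact: le_trans xy.
Qed.

End radius_optimization.

Section weights.
Context {R : realType} {K : closedFieldType} (v : absvalue R K).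
Variables (H : P1berk v -> P1berk v -> R) (H_can : is_can_kernel H).
Variables (g : P1berk v -> R) (g_cont : continuous g).
Variables (kappa : R) (g_holder : has_ubound (holder_quotients g kappa)).
Local Notation P := (unit_prob R).
Local Notation C := (sup (holder_quotients g kappa)).
Local Notation supg := (sup (range (fun S => `|g S|))).

Lemma holder_quotient_ge0 r : holder_quotients g kappa r -> 0 <= r.
Proof. by move=> [z [w [_ ->]]]; rewrite divr_ge0 ?powR_ge0. Qed.

Lemma holder_constant_ge0 : 0 <= C.
Proof.
have [[r hr]|h0] := pselect (holder_quotients g kappa !=set0).
  apply: le_trans (holder_quotient_ge0 hr) _.
  by apply: sup_upper_bound => //; split => //; exists r.
rewrite (_ : holder_quotients g kappa = set0) ?sup0//.
by apply/seteqP; split=> // r hr; apply: h0; exists r.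
Qed.

Lemma holder_le z w : z != w ->
  g (typeI v w) <= g (typeI v z) + C * chordal v z w `^ kappa^-1.
Proof.
move=> zw; have c0 : 0 < chordal v z w `^ kappa^-1.
  by rewrite powR_gt0// chordal_gt0.
rewrite -lerBlDl; apply: le_trans (ler_norm _) _; rewrite distrC -ler_pdivrMr//.
have hr : holder_quotients g kappa
  (`|g (typeI v z) - g (typeI v w)| / chordal v z w `^ kappa^-1) by exists z, w.
by apply: sup_upper_bound => //; split => //; eexists; exact: hr.
Qed.

Lemma norm_le_supg S : `|g S| <= supg.
Proof.
have [G _ gG] := continuous_P1berk_bounded g_cont.
apply: sup_upper_bound; last by exists S.
by split; [exists `|g S|; exists S|exists G => _ [S' _ <-]].
Qed.

(** Distinct points have positive chordal distance, so all logarithms in the sum are finite. *)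
Lemma fekete_sumE (F : {fset P1 K}) :
  fekete_sum H g F = (\sum_(i < #|` F|) \sum_(j < #|` F|)
    (if i == j then 0 else ln (chordal v (nth None F i) (nth None F j))
      - g (typeI v (nth None F i)) - g (typeI v (nth None F j))))%:E.
Proof.
have [HE _ _ _] := H_can.
rewrite /fekete_sum (big_nth None) big_mkord -sumEFin; apply: eq_bigr => i _.
rewrite (big_nth None) big_mkord -sumEFin big_mkcond; apply: eq_bigr => j _.
rewrite nth_uniq ?fset_uniq// eq_sym; case: (eqVneq i j) => [->|ij].
  by rewrite eqxx.
have -> : (nat_of_ord i == j) = false by apply/negbTE.
rewrite /= /Phi HE lne_EFin ?EFinB// chordal_gt0//.
by rewrite nth_uniq ?fset_uniq.
Qed.

End weights.

(** * The regularized inequality in the two cases *)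

Section regularization.
Context {R : realType} {K : closedFieldType} (v : absvalue R K).
Variables (H : P1berk v -> P1berk v -> R) (H_can : is_can_kernel H).
Variables (g : P1berk v -> R) (g_cont : continuous g).
Hypothesis g_energy : equilibrium_energy H g = 0%E.
Variables (kappa : R) (g_holder : has_ubound (holder_quotients g kappa)).
Local Notation P := (unit_prob R).
Local Notation C := (sup (holder_quotients g kappa)).

Variables (n : nat) (z : nat -> P1 K).
Hypothesis z_inj : forall i j, (i <= n)%N -> (j <= n)%N -> i != j -> z i != z j.

(** The curves are constant at disk points, so all means are values of the kernel. These dominate
    both the radius and the chordal distances, which allows [c = 1]. *)
Lemma nonarchimedean_regularization (b : K) :
  nonarchimedean v -> 0 < v b <= 1 ->
  \sum_(i < n.+1) \sum_(j < n.+1)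
    ((if i == j then ln (1 * v b) else 2 * ln 1 + ln (chordal v (z i) (z j)))
     - g (typeI v (z i)) - g (typeI v (z j)) - 2 * (C * v b `^ kappa^-1)) <= 0.
Proof.
move=> v_na /andP[b0 b1].
have /choice[x xP] i : exists x : A1berk v, disk_point (z i) (v b) (Some x).
  have [zeta zz] := disk_point_exists v_na (z i) b1.
  by have [x xE] := disk_point_Some v_na H_can b0 zz; exists x; rewrite -xE.
have Hxx i j := disk_point_kernel v_na H_can (xP i) (xP j).
have Hxz i j := disk_point_kernel_typeI v_na H_can (z j) (xP i).
have max_gt0 (r : R) : 0 < Num.max (v b) r by rewrite lt_max b0.
have int_cst (r : R) : 0 < r -> (\int[P]_t lne r%:E = (ln r)%:E)%E.
  by move=> r0; rewrite lne_EFin// integral_cst//= probability_setT mule1.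
apply: (@regularized_energy_le0 _ _ _ _ H_can _ g_cont n z (fun i _ => x i)) => //.
- by move=> i t; exact: cvg_cst.
- by rewrite ltr01 lexx.
(* The Hoelder bound holds at every [w k], at distance [v b] from [z i], and passes to the cluster
   point by continuity of [g]. *)
- move=> i t ni; have [w [w1 w2 cw]] := xP i.
  apply: (cluster_le cw g_cont); exists 0%N => k _.
  rewrite -(w1 k); apply: holder_le => //.
  by apply/negP => /eqP E; move: b0; rewrite -(w1 k) -E chordalxx ltxx.
- by move=> i j t u _ _; rewrite Hxx ge_max b1 chordal_le1_na.
- by move=> i j t _ _; rewrite Hxz ge_max b1 chordal_le1_na.
- move=> i t ni; rewrite Hxx int_cst// mul1r lee_fin ler_ln ?posrE//.
  by rewrite le_max lexx.
- by move=> i j t ni nj ij; rewrite Hxx Hxz int_cst// ln1 add0e lne_EFin.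
- move=> i j ni nj ij; rewrite Hxz int_cst// ln1 add0r lee_fin.
  by rewrite ler_ln ?posrE ?chordal_gt0 ?z_inj// le_max lexx orbT.
Qed.

(** The potential of a circle is at least [ln c] plus the logarithm of the distance to its center.
    It is used first at a point of another circle, then at the center of that circle. *)
Lemma archimedean_regularization (sigma : {rmorphism R[i] -> K}) (s c : R) :
  complex_iso v sigma -> ~ nonarchimedean v ->
  0 < s -> 0 < c <= 1 -> c ^+ 2 + s ^+ 2 = 1 ->
  (forall i, s != chordal v (z i) None) ->
  \sum_(i < n.+1) \sum_(j < n.+1)
    ((if i == j then ln (c * s) else 2 * ln c + ln (chordal v (z i) (z j)))
     - g (typeI v (z i)) - g (typeI v (z j)) - 2 * (C * s `^ kappa^-1)) <= 0.
Proof.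
move=> iso v_arch s0 /andP[c0 c1] cs sz.
have [HE _ _ _] := H_can.
pose w i t := circle_coord sigma c s (z i) t.
pose del i t : A1berk v := A1Berk (eval_mult_seminorm v (w i t)).
have delE i t : Some (del i t) = typeI v (Some (w i t)) by [].
have zw i t : chordal v (z i) (Some (w i t)) = s.
  exact: chordal_circle_center.
have le1 := chordal_le1_arch iso v_arch.
have mean i y := mean_lne_chordal_circle iso v_arch c0 s0 cs y (sz i).
have lnMc (y : R) : 0 <= y -> ((ln c)%:E + lne y%:E = lne (c * y)%:E)%E.
  rewrite le_eqVlt => /predU1P[<-|y0]; first by rewrite mulr0 le0_lneNy.
  by rewrite !lne_EFin ?mulr_gt0// lnM ?posrE// EFinD.
have mean' i y : ((ln c)%:E + lne (chordal v (z i) y)%:E <=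
    \int[P]_t lne (chordal v (Some (w i t)) y)%:E)%E.
  apply: le_trans (mean i y); rewrite lnMc ?chordal_ge0//.
  apply: le_lne_EFin; last by rewrite le_max lexx.
  by rewrite mulr_ge0 ?(ltW c0) ?chordal_ge0.
apply: (@regularized_energy_le0 _ _ _ _ H_can _ g_cont n z del) => //.
- move=> i; apply: continuous_A1berk => f.
  apply: absv_continuousP; apply: absv_continuous_horner.
  exact: circle_coord_continuous.
- by rewrite c0 c1.
- move=> i t ni; rewrite delE -(zw i t); apply: holder_le => //.
  by apply/negP => /eqP E; move: s0; rewrite -(zw i t) -E chordalxx ltxx.
- by move=> i j t u _ _; rewrite !delE HE.
- by move=> i j t _ _; rewrite delE HE.
- move=> i t ni.
  under eq_integral do rewrite !delE HE chordalC.
  (* A point of the circle is at distance [s] from the center, so the potential there is at least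
     [ln (c * s)]. *)
  apply: le_trans (mean i _); rewrite zw -lne_EFin ?mulr_gt0//.
  apply: le_lne_EFin; last by rewrite le_max lexx.
  by rewrite mulr_ge0 ?(ltW c0) ?(ltW s0).
- move=> i j t ni nj ij; rewrite delE HE chordalC.
  under eq_integral do rewrite !delE HE chordalC.
  exact: mean'.
- move=> i j ni nj ij.
  under eq_integral do rewrite !delE HE.
  apply: le_trans (mean' i (z j)).
  by rewrite lne_EFin ?EFinD// chordal_gt0// z_inj.
Qed.

End regularization.

(** For [s] at most one half, [c >= c ^+ 2 >= 1 - s / 2], hence [c^-1 - 1 <= s], and [ln (c^-1)] is
    at most [c^-1 - 1]. This is the origin of the archimedean error term. *)
Lemma neg_ln_sqrt_le (R : realType) (s : R) : 0 < s <= 2^-1 ->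
  let c := Num.sqrt (1 - s ^+ 2) in
  [/\ 0 < c <= 1, c ^+ 2 + s ^+ 2 = 1 & - ln c <= s].
Proof.
move=> /andP[s0 s1] c.
have s21 : 1 - s ^+ 2 >= 1 - s / 2 by rewrite lerD2l lerN2; nra.
have p0 : 0 < 1 - s ^+ 2 by rewrite (lt_le_trans _ s21)//; lra.
have cE : c ^+ 2 = 1 - s ^+ 2 by rewrite sqr_sqrtr// ltW.
have c0 : 0 < c by rewrite sqrtr_gt0.
have c1 : c <= 1.
  by rewrite -(@ler_pXn2r _ 2)// ?nnegrE ?(ltW c0)// cE expr1n; nra.
split; [by rewrite c0|by rewrite cE subrK|].
have cs : 1 - s / 2 <= c by rewrite (le_trans s21)// -cE; nra.
have ci : c^-1 - 1 <= s.
  rewrite lerBlDr -[c^-1]mul1r ler_pdivrMr//; nra.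
rewrite -lnV ?posrE// (le_trans _ ci)//.
have -> : c^-1 = 1 + (c^-1 - 1) by lra.
rewrite [leRHS](_ : _ = c^-1 - 1); last by lra.
by apply: le_ln1Dx; rewrite ltrBrDl subrr invr_gt0.
Qed.

Theorem theorem1 (R : realType) (K : closedFieldType) (v : absvalue R K)
    (v_nontrivial : nontrivial_abs v) (v_complete : complete_abs v)
    (v_arch : ~ nonarchimedean v ->
       exists sigma : {rmorphism R[i] -> K}, complex_iso v sigma)
    (H : P1berk v -> P1berk v -> R) (H_can : is_can_kernel H)
    (g : P1berk v -> R) (g_normalized : normalized_weight H g)
    (kappa : R) (kappa_ge1 : 1 <= kappa)
    (g_holder : has_ubound (holder_quotients g kappa)) :
  let C := sup (holder_quotients g kappa) in
  let C' := if `[< nonarchimedean v >] then C * 2 `^ kappa^-1 else C in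
  let epsK : R := if `[< nonarchimedean v >] then 0 else 1 in
  let supg := sup (range (fun S => `|g S|)) in
  (forall F : {fset P1 K}, F != fset0 ->
     let n : R := #|` F|%:R in
     (fekete_sum H g F <=
      (kappa * n * ln n +
       2 * n * (C' + epsK * n `^ (1 - kappa) + supg))%:E)%E) /\
  (limn_esup (fun N : nat =>
     ereal_sup [set fekete_sum H g F *
                    ((#|` F|%:R * ln #|` F|%:R)^-1)%:E
               | F in [set F : {fset P1 K} | (0 < N <= #|` F|)%N]])
   <= kappa%:E)%E.
Proof.
move=> C C' epsK supg.
have [[g_cont _] g_energy] := g_normalized.
have C0 : 0 <= C by exact: holder_constant_ge0.
have kp0 : 0 < kappa by rewrite (lt_le_trans ltr01).
have CC' : C <= C'.
  rewrite /C'; case: asboolP => // _; rewrite ler_peMr//.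
  rewrite -[leLHS](@powRr0 _ 2); apply: ler_powR; first by rewrite ler1n.
  by rewrite invr_ge0 ltW.
have supg0 : 0 <= supg by apply: le_trans (norm_le_supg g_cont None).
have eps0 : 0 <= epsK by rewrite /epsK; case: asboolP.
have eps1 : epsK <= 1 by rewrite /epsK; case: asboolP.
have powN_le (N : nat) (a b : R) : (0 < N)%N -> a <= b -> N%:R `^ a <= N%:R `^ b :> R.
  by move=> N0 ab; apply: ler_powR => //; rewrite ler1n.
have main (F : {fset P1 K}) : F != fset0 -> let n : R := #|` F|%:R in
   (fekete_sum H g F <= (kappa * n * ln n +
       2 * n * (C' + epsK * n `^ (1 - kappa) + supg))%:E)%E.
  move=> F0 /=; set n : R := #|` F|%:R.
  have cF : (0 < #|` F|)%N by rewrite cardfs_gt0.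
  have n0 : 0 < n by rewrite ltr0n.
  (* A single point is treated apart: its sum is 0, and the radius would be 1, whereas at least two
     points make it at most one half. *)
  have [cF1|cF2] := leqP #|` F| 1.
    have n1 : #|` F| = 1%N by apply/eqP; rewrite eqn_leq cF1.
    rewrite fekete_sumE// lee_fin /n n1 !big_ord1 eqxx ln1 mulr0 add0r powR1.
    by rewrite !mulr1 mulr_ge0// !addr_ge0// (le_trans C0).
  rewrite fekete_sumE// lee_fin.
  (* The regularization gives the bound with [C], which is at most [C']. *)
  apply: (@le_trans _ _ (kappa * n * ln n + 2 * n * (C + epsK * n `^ (1 - kappa) + supg))).
    apply: (sum_le_optimal_radius (h := fun i => g (typeI v (nth None F i)))
      (d := fun i j => ln (chordal v (nth None F i) (nth None F j)))) => //.
      by move=> i; exact: norm_le_supg.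
    move=> delta delta0.
    have /prednK := cF; set m := #|` F|.-1 => mE; rewrite -mE -/n.
    have nE : m.+1%:R = n by rewrite mE.
    rewrite nE; set ep := n `^ (- kappa).
    have ep0 : 0 < ep by rewrite powR_gt0.
    have ep2 : ep <= 2^-1.
      apply: (@le_trans _ _ (n `^ (- 1))); first by apply: powN_le => //; rewrite lerN2.
      by rewrite powRN powRr1 ?(ltW n0)// lef_pV2 ?posrE// ler_nat.
    have z_inj i j : (i <= m)%N -> (j <= m)%N -> i != j -> nth None F i != nth None F j.
      by move=> im jm ij; rewrite nth_uniq ?fset_uniq// -/(#|` F|) -mE ltnS.
    have [v_na|v_ar] := pselect (nonarchimedean v).
      have [|b /andP[b1 b2]] := @value_group_dense _ _ v ep (expR delta) v_nontrivial ep0.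
        by rewrite expR_gt1.
      have b0 : 0 < v b by rewrite (lt_le_trans _ b1)// divr_gt0// expR_gt0.
      exists (v b), 1; split => //.
      - by rewrite b2 andbT expRN mulrC.
      - by rewrite ln1 oppr0 mulr_ge0 ?(ltW ep0).
      - apply: (nonarchimedean_regularization H_can g_cont g_energy g_holder z_inj) => //.
        by rewrite b0 (le_trans b2)// (le_trans ep2)// invf_le1 ?ler1n.
    have [sigma iso] := v_arch v_ar.
    (* Finitely many distances to infinity have to be avoided: slightly below [ep], a radius is
       smaller than those that are at least [ep] and larger than the others. *)
    have [s [s1 s2 sz]] : exists s, [/\ expR (- delta) * ep < s, s < ep &
        forall i : 'I_m.+1, s != chordal v (nth None F i) None].
      apply: (@filter_ex _ (ep^'-)); near=> s; split.
      - near: s; apply: nbhs_left_gt.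
        by rewrite gtr_pMl// -[ltRHS](@expR0 R) ltr_expR oppr_lt0.
      - by near: s; exact: nbhs_left_lt.
      - near: s; apply: filter_forall => i.
        have [ei|ei] := leP ep (chordal v (nth None F i) None); near=> s.
          by rewrite lt_eqF// (lt_le_trans _ ei)//; near: s; exact: nbhs_left_lt.
        by rewrite gt_eqF//; near: s; exact: nbhs_left_gt.
    have s0 : 0 < s by rewrite (lt_trans _ s1)// mulr_gt0// expR_gt0.
    have [|c01 cs lc] := @neg_ln_sqrt_le _ s.
      by rewrite s0 (le_trans _ ep2)// ltW.
    exists s, (Num.sqrt (1 - s ^+ 2)); split => //.
    - by rewrite (ltW s1) ltW.
    - by case/andP: c01.
    - by rewrite /epsK asboolF// mul1r (le_trans lc)// ltW.
    - apply: (archimedean_regularization H_can g_cont g_energy g_holder z_inj iso) => //.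
      (* Beyond the last point of [F] the default value is infinity, at distance 0 from itself and
         so different from [s]. *)
      move=> i; have [im|im] := ltnP i m.+1; first exact: (sz (Ordinal im)).
      by rewrite nth_default ?chordalxx ?gt_eqF// -mE.
  by rewrite lerD2l ler_pM2l ?mulr_gt0// !lerD2r.
split => //.
pose B := 2 * (C' + 1 + supg).
have B0 : 0 <= B by rewrite mulr_ge0// !addr_ge0// (le_trans C0).
apply/lee_addgt0Pr => e e0; rewrite limn_esup_lim.
apply: lime_le; first exact: is_cvg_esups.
near=> M; apply: ge_ereal_sup => _ [N /= MN <-].
apply: ge_ereal_sup => _ [F /andP[N0 NF] <-].
have MF : (M <= #|` F|)%N by exact: leq_trans NF.
have F2 : (2 <= #|` F|)%N by apply: leq_trans MF; near: M; exact: nbhs_infty_ge.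
have F0 : F != fset0 by rewrite -cardfs_gt0 (leq_trans _ F2).
have := main F F0; rewrite /= fekete_sumE// -EFinM -EFinD !lee_fin.
set T := \sum_(i < _) _; set n : R := #|` F|%:R => Tn.
have n0 : 0 < n by rewrite ltr0n (leq_trans _ F2).
have lnn : 0 < ln n by rewrite ln_gt0// ltr1n.
have n1 : n `^ (1 - kappa) <= 1.
  by rewrite -[leRHS](@powRr0 _ n); apply: powN_le; rewrite ?subr_le0// (leq_trans _ F2).
(* [M] is taken at least [expR (B / e)], so that the error divided by [n * ln n] is at most [e] for
   all sets with at least [M] points. *)
have Ben : B <= e * ln n.
  rewrite -ler_pdivrMl// mulrC -ler_expR lnK ?posrE//.
  apply: (@le_trans _ _ M%:R); last by rewrite ler_nat.
  by near: M; exact: nbhs_infty_ger.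
rewrite ler_pdivrMr ?mulr_gt0//; apply: (le_trans Tn).
have en : epsK * n `^ (1 - kappa) <= 1 by rewrite mulr_ile1 ?powR_ge0.
have : n * B <= n * (e * ln n) by rewrite ler_pM2l.
have : n * (2 * (C' + epsK * n `^ (1 - kappa) + supg)) <= n * B.
  by rewrite ler_pM2l// ler_pM2l// lerD2r lerD2l.
by rewrite /B; lra.
Unshelve. all: by end_near. Qed.
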